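(* For each finite simplicial graph $\Gamma$, the following hold. (1) If $\Gamma$ is a tree, then $\operatorname{Spec}(A(\Gamma))$ is a set of even integers. (2) If $\Gamma$ is a cycle of even length more than $5$, then $\operatorname{Spec}(A(\Gamma))$ is a set of integers. (3) If $\Gamma$ is a cycle of odd length more than $5$, then $\operatorname{Spec}(A(\Gamma))$ is a set of rational numbers of denominator $2$ (i.e. $\operatorname{Spec}(A(\Gamma))\subseteq\{n/2\mid n\in\mathbb{Z}\}$), and furthermore it contains a non-integer value.
   Context: For a finite connected simplicial graph $\Gamma$, $A(\Gamma)=\langle v\in V(\Gamma)\mid [u,v]=1 \text{ for all } \{u,v\}\in E(\Gamma)\rangle$ is its right-angled Artin group. For $x,h\in A(\Gamma)$ write $x^h=h^{-1}xh$. The extension graph $\Gamma^e$ is the simplicial graph with vertex set $\{v^g\mid v\in V(\Gamma), g\in A(\Gamma)\}\subset A(\Gamma)$, where two distinct vertices are joined by an edge exactly when they commute in $A(\Gamma)$. It carries the edge metric $d_{\Gamma^e}$. $A(\Gamma)$ acts on $\Gamma^e$ on the right by conjugation, $x\mapsto x^g$. The asymptotic translation length of $g$ is $\tau(g)=\lim_{n\to\infty} d_{\Gamma^e}(x,x^{g^n})/n$ (independent of the vertex $x$), and $\operatorname{Spec}(A(\Gamma))=\{\tau(g)\mid g\in A(\Gamma)\}$. *)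

(* Defs.v *)
From HB Require Import structures.
From mathcomp Require Import all_boot all_order all_algebra.
From mathcomp Require Import all_classical all_reals all_analysis.
Import numFieldNormedType.Exports.

Set Implicit Arguments.
Unset Strict Implicit.
Unset Printing Implicit Defensive.

Import Order.TTheory GRing.Theory Num.Theory.

Record sgraph := SGraph {
  svertex :> finType;
  adj : rel svertex;
  adj_sym : symmetric adj;
  adj_irr : irreflexive adj }.

Arguments adj {s}.

Definition connected_graph (G : sgraph) : Prop :=
  0 < #|G| /\ forall u v : G, connect adj u v.

(* [ucycle adj [:: u; v]] holds as soon as [u] and [v] are adjacent, so only
   duplicate-free closed walks with at least three vertices are cycles. *)
Definition acyclic_graph (G : sgraph) : Prop :=
  forall c : seq G, ucycle adj c -> size c <= 2.

Definition tree_graph (G : sgraph) : Prop :=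
  connected_graph G /\ acyclic_graph G.

Definition cycle_graph (n : nat) (G : sgraph) : Prop :=
  2 < n /\ exists2 f : 'I_n -> G, bijective f
    & forall i j, adj (f i) (f j) = (j == ordS i) || (i == ordS j).

Section RightAngledArtinGroup.
Variable G : sgraph.

(* The letter [(v, true)] stands for the generator [v], and [(v, false)] for
   its inverse. *)
Definition word := seq (G * bool).

Inductive raag_eq : word -> word -> Prop :=
| raag_refl w : raag_eq w w
| raag_sym w1 w2 : raag_eq w1 w2 -> raag_eq w2 w1
| raag_trans w1 w2 w3 : raag_eq w1 w2 -> raag_eq w2 w3 -> raag_eq w1 w3
| raag_cat w1 w1' w2 w2' :
    raag_eq w1 w1' -> raag_eq w2 w2' -> raag_eq (w1 ++ w2) (w1' ++ w2')
| raag_cancel v b : raag_eq [:: (v, b); (v, ~~ b)] [::]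
| raag_comm u v : adj u v ->
    raag_eq [:: (u, true); (v, true)] [:: (v, true); (u, true)].

Definition raag_eqb : rel word := fun w1 w2 => `[< raag_eq w1 w2 >].

Lemma raag_eqb_refl : reflexive raag_eqb.
Proof. by move=> w; apply/asboolP/raag_refl. Qed.

Lemma raag_eqb_sym : symmetric raag_eqb.
Proof. by move=> w1 w2; apply/asboolP/asboolP; apply: raag_sym. Qed.

Lemma raag_eqb_trans : transitive raag_eqb.
Proof.
move=> w2 w1 w3 /asboolP h1 /asboolP h2; apply/asboolP; exact: raag_trans h1 h2.
Qed.

Canonical raag_equiv := EquivRel raag_eqb raag_eqb_refl raag_eqb_sym
  raag_eqb_trans.

Definition raag := {eq_quot raag_equiv}%qT.

HB.instance Definition _ := Choice.on raag.
HB.instance Definition _ := EqQuotient.on raag.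

Lemma raag_piP (w1 w2 : word) :
  reflect (raag_eq w1 w2) (\pi_raag w1 == \pi_raag w2)%qT.
Proof. by rewrite eqmodE; apply: asboolP. Qed.

Lemma raag_reprP (w : word) : raag_eq (repr (\pi_raag w)%qT) w.
Proof. by apply/raag_piP; rewrite reprK. Qed.

Definition inv_letter (s : G * bool) : G * bool := (s.1, ~~ s.2).

Definition inv_word (w : word) : word := rev (map inv_letter w).

Lemma inv_letterK : involutive inv_letter.
Proof. by case=> v b; rewrite /inv_letter /= negbK. Qed.

Lemma inv_wordK : involutive inv_word.
Proof.
move=> w; rewrite /inv_word map_rev revK -map_comp -[RHS]map_id.
by apply: eq_map => s; apply: inv_letterK.
Qed.

Lemma cat_inv_word (w : word) : raag_eq (w ++ inv_word w) [::].
Proof.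
elim: w => [|[v b] w IHw]; first exact: raag_refl.
rewrite /inv_word /= rev_cons -/(inv_word w) -cats1 catA.
rewrite -[_ :: (_ ++ _)]/([:: (v, b)] ++ ((w ++ inv_word w) ++ _)).
apply: raag_trans (raag_cancel v b).
by apply: raag_cat (raag_refl _) (raag_cat IHw (raag_refl _)).
Qed.

Lemma inv_cat_word (w : word) : raag_eq (inv_word w ++ w) [::].
Proof. by rewrite -{2}[w]inv_wordK; apply: cat_inv_word. Qed.

Lemma inv_word_eq w1 w2 : raag_eq w1 w2 -> raag_eq (inv_word w1) (inv_word w2).
Proof.
move=> h; rewrite -[inv_word w2]cat0s -[inv_word w1]cats0.
apply: raag_trans (raag_cat (raag_refl _) (raag_sym (cat_inv_word w2))) _.
rewrite catA; apply: raag_cat (raag_refl _).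
apply: raag_trans (inv_cat_word w1).
exact: raag_cat (raag_refl _) (raag_sym h).
Qed.

Definition raag_one : raag := (\pi_raag [::])%qT.
Definition raag_inv (x : raag) : raag := (\pi_raag (inv_word (repr x)))%qT.
Definition raag_mul (x y : raag) : raag := (\pi_raag (repr x ++ repr y))%qT.

Lemma raag_mulE w1 w2 :
  raag_mul (\pi_raag w1)%qT (\pi_raag w2)%qT = (\pi_raag (w1 ++ w2))%qT.
Proof. by apply/eqP/raag_piP/raag_cat; apply: raag_reprP. Qed.

Lemma raag_invE w : raag_inv (\pi_raag w)%qT = (\pi_raag (inv_word w))%qT.
Proof. by apply/eqP/raag_piP/inv_word_eq/raag_reprP. Qed.

Lemma raag_mulA : associative raag_mul.
Proof.
move=> x y z; rewrite -[x](@reprK _ raag) -[y](@reprK _ raag).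
by rewrite -[z](@reprK _ raag) !raag_mulE catA.
Qed.

Lemma raag_mul1 : left_id raag_one raag_mul.
Proof. by move=> x; rewrite -[x](@reprK _ raag) raag_mulE. Qed.

Lemma raag_mulr1 : right_id raag_one raag_mul.
Proof. by move=> x; rewrite -[x](@reprK _ raag) raag_mulE cats0. Qed.

Lemma raag_mulV : left_inverse raag_one raag_inv raag_mul.
Proof.
move=> x; rewrite -[x](@reprK _ raag) raag_invE raag_mulE.
by apply/eqP/raag_piP/inv_cat_word.
Qed.

Lemma raag_mulrV : right_inverse raag_one raag_inv raag_mul.
Proof.
move=> x; rewrite -[x](@reprK _ raag) raag_invE raag_mulE.
by apply/eqP/raag_piP/cat_inv_word.
Qed.

HB.instance Definition _ := isGroup.Build raag
  raag_mulA raag_mul1 raag_mulr1 raag_mulV raag_mulrV.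

Definition raag_gen (v : G) : raag := (\pi_raag [:: (v, true)])%qT.

Local Open Scope group_scope.

Lemma raag_gen_comm (u v : G) : adj u v -> commute (raag_gen u) (raag_gen v).
Proof.
move=> uv; rewrite /commute [LHS]raag_mulE [RHS]raag_mulE.
by apply/eqP/raag_piP/raag_comm.
Qed.

Lemma raag_ind (P : raag -> Prop) : P 1 ->
  (forall v g, P g -> P (raag_gen v * g)) ->
  (forall v g, P g -> P ((raag_gen v)^-1 * g)) -> forall g, P g.
Proof.
move=> P1 PM PV g; rewrite -[g](@reprK _ raag).
elim: (repr g) => [|[v b] w IHw] //.
have -> : (\pi_raag ((v, b) :: w) = \pi_raag [:: (v, b)] * \pi_raag w)%qT.
  by rewrite [RHS]raag_mulE.
case: b; first exact: PM.
suff -> : (\pi_raag [:: (v, false)])%qT = (raag_gen v)^-1 by apply: PV.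
by rewrite [RHS]raag_invE.
Qed.

Lemma raag_lift (H : groupType) (f : G -> H) :
  (forall u v, adj u v -> commute (f u) (f v)) ->
  exists2 F : raag -> H, {morph F : x y / x * y} & forall v, F (raag_gen v) = f v.
Proof.
move=> fC.
pose l (s : G * bool) : H := if s.2 then f s.1 else (f s.1)^-1.
pose ev (w : word) : H := foldr (fun s h => l s * h) 1 w.
have ev_cat w1 w2 : ev (w1 ++ w2) = ev w1 * ev w2.
  by elim: w1 => [|s w1 IH] /=; rewrite ?mul1g // IH mulgA.
have ev_eq w1 w2 : raag_eq w1 w2 -> ev w1 = ev w2.
  elim=> // {w1 w2} [w1 w2 w3 _ -> _ -> //|w1 w1' w2 w2' _ h1 _ h2|v b|u v uv].
  - by rewrite !ev_cat h1 h2.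
  - by rewrite /= mulg1; case: b; rewrite /l /= ?mulgV ?mulVg.
  - by rewrite /= !mulg1 /l /=; apply: fC.
exists (fun x => ev (repr x)) => [x y|v].
  by rewrite -ev_cat; apply: ev_eq; apply: raag_reprP.
by rewrite (ev_eq _ _ (raag_reprP _)) /= mulg1.
Qed.

Definition ext_vertexb : pred raag :=
  fun x => `[< exists v g, x = raag_gen v ^ g >].

Definition ext_vertex := {x : raag | ext_vertexb x}.

HB.instance Definition _ := Choice.on ext_vertex.
HB.instance Definition _ := SubType.on ext_vertex.

Definition ext_adj : rel ext_vertex :=
  fun x y => (x != y) && (val x * val y == val y * val x).

Lemma ext_actP (x : ext_vertex) (h : raag) : ext_vertexb (val x ^ h).
Proof.
have /asboolP[v [g ->]] := valP x.
by apply/asboolP; exists v, (g * h); rewrite conjgM.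
Qed.

Definition ext_act (x : ext_vertex) (h : raag) : ext_vertex :=
  exist _ (val x ^ h) (ext_actP x h).

End RightAngledArtinGroup.

Arguments ext_adj {G}.

Section GraphDistance.
Variables (T : eqType) (e : rel T).

Definition walk_of_length (x y : T) (n : nat) : bool :=
  `[< exists p, [/\ path e x p, last x p = y & size p = n] >].

(* Junk value [0] when [x] and [y] are not joined by a walk. *)
Definition gdist (x y : T) : nat :=
  if pselect (exists n, walk_of_length x y n) is left h then ex_minn h else 0.

Lemma gdist_le x p : path e x p -> gdist x (last x p) <= size p.
Proof.
move=> ep; rewrite /gdist; case: pselect => // h; case: ex_minnP => m _.
by apply; apply/asboolP; exists p.
Qed.

Lemma gdist_walk x y : (exists2 p, path e x p & last x p = y) ->
  exists p, [/\ path e x p, last x p = y & size p = gdist x y].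
Proof.
case=> p ep lp; rewrite /gdist; case: pselect => [h|[]].
  by case: ex_minnP => m /asboolP.
by exists (size p); apply/asboolP; exists p.
Qed.

Lemma gdist_triangle : (forall x y, exists2 p, path e x p & last x p = y) ->
  forall y x z, gdist x z <= gdist x y + gdist y z.
Proof.
move=> C y x z; have [p [ep lp <-]] := gdist_walk (C x y).
have [q [eq lq <-]] := gdist_walk (C y z).
rewrite -size_cat -lq -lp -last_cat; apply: gdist_le.
by rewrite cat_path ep lp.
Qed.

End GraphDistance.

Definition ext_dist (G : sgraph) (x y : ext_vertex G) : nat :=
  gdist ext_adj x y.

Section ExtensionGraphTheory.
Variable G : sgraph.
Local Open Scope group_scope.
Implicit Types (x y z : ext_vertex G) (g h : raag G).

Lemma ext_adj_sym : symmetric (@ext_adj G).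
Proof. by move=> x y; rewrite /ext_adj eq_sym [X in _ && X]eq_sym. Qed.

Lemma ext_adj_irr : irreflexive (@ext_adj G).
Proof. by move=> x; rewrite /ext_adj eqxx. Qed.

Lemma ext_act1 x : ext_act x 1 = x.
Proof. by apply: val_inj; rewrite /= conjg1. Qed.

Lemma ext_actM x g h : ext_act x (g * h) = ext_act (ext_act x g) h.
Proof. by apply: val_inj; rewrite /= conjgM. Qed.

Lemma ext_act_inj h : injective (fun x => ext_act x h).
Proof.
move=> x y /(congr1 (fun z => ext_act z h^-1)).
by rewrite -!ext_actM mulgV !ext_act1.
Qed.

Lemma ext_act_adj h x y : ext_adj (ext_act x h) (ext_act y h) = ext_adj x y.
Proof.
rewrite /ext_adj (inj_eq (@ext_act_inj h)) /= -!conjMg; congr (_ && _).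
by rewrite (inj_eq (can_inj (conjgK h))).
Qed.

Lemma ext_act_path h x p :
  path ext_adj (ext_act x h) (map (fun z => ext_act z h) p) = path ext_adj x p.
Proof. by elim: p x => //= y p IH x; rewrite IH ext_act_adj. Qed.

Definition ext_reach x y : Prop := exists2 p, path ext_adj x p & last x p = y.

Lemma ext_reach_trans y x z : ext_reach x y -> ext_reach y z -> ext_reach x z.
Proof.
move=> [p ep <-] [q eq <-].
by exists (p ++ q); rewrite ?last_cat // cat_path ep.
Qed.

Lemma ext_reach_sym x y : ext_reach x y -> ext_reach y x.
Proof.
move=> [p ep <-]; exists (rev (belast x p)).
  by rewrite rev_path; under eq_path do rewrite ext_adj_sym.
by case: p {ep} => //= y' p; rewrite rev_cons last_rcons.
Qed.

Lemma ext_reach_act h x y : ext_reach x y -> ext_reach (ext_act x h) (ext_act y h).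
Proof.
move=> [p ep <-]; exists (map (fun z => ext_act z h) p).
  by rewrite ext_act_path.
by rewrite (last_map (fun z => ext_act z h)).
Qed.

Lemma ext_genP (v : G) : ext_vertexb (raag_gen v).
Proof. by apply/asboolP; exists v, 1; rewrite conjg1. Qed.

Definition ext_gen (v : G) : ext_vertex G := exist _ (raag_gen v) (ext_genP v).

Lemma ext_genE x : exists v g, x = ext_act (ext_gen v) g.
Proof.
by have /asboolP[v [g e]] := valP x; exists v, g; apply: val_inj.
Qed.

Hypothesis Gconn : connected_graph G.

Lemma ext_reach_gen u v : ext_reach (ext_gen u) (ext_gen v).
Proof.
have /connectP[p ep ->] := Gconn.2 u v.
elim: p u ep => [|w p IH] u /=; first by exists [::].
case/andP=> uw /IH; apply: ext_reach_trans.
have [->|ne] := eqVneq (ext_gen u) (ext_gen w); first by exists [::].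
exists [:: ext_gen w] => //=; rewrite andbT /ext_adj ne /=.
exact/eqP/raag_gen_comm.
Qed.

Lemma ext_reach_gen_act v g : ext_reach (ext_gen v) (ext_act (ext_gen v) g).
Proof.
have fixed s : ext_act (ext_gen s) (raag_gen s) = ext_gen s.
  by apply: val_inj; rewrite /= conjgE mulKg.
have fixedV s : ext_act (ext_gen s) (raag_gen s)^-1 = ext_gen s.
  by rewrite -{1}[ext_gen s]fixed -ext_actM mulgV ext_act1.
elim/raag_ind: g => [|s g IH|s g IH]; first by rewrite ext_act1; exists [::].
- rewrite ext_actM; apply: ext_reach_trans IH (ext_reach_act _ _).
  apply: ext_reach_trans (ext_reach_gen v s) _; rewrite -{1}fixed.
  exact/ext_reach_act/ext_reach_gen.
- rewrite ext_actM; apply: ext_reach_trans IH (ext_reach_act _ _).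
  apply: ext_reach_trans (ext_reach_gen v s) _; rewrite -{1}fixedV.
  exact/ext_reach_act/ext_reach_gen.
Qed.

Lemma ext_connected x y : ext_reach x y.
Proof.
have [u [g ->]] := ext_genE x; have [v [h ->]] := ext_genE y.
apply: ext_reach_trans (ext_reach_sym (ext_reach_gen_act u g)) _.
exact: ext_reach_trans (ext_reach_gen u v) (ext_reach_gen_act v h).
Qed.

Lemma ext_dist_triangle y x z : ext_dist x z <= ext_dist x y + ext_dist y z.
Proof. exact: gdist_triangle ext_connected y x z. Qed.

Lemma ext_dist_act h x y : ext_dist (ext_act x h) (ext_act y h) = ext_dist x y.
Proof.
have le k x' y' : ext_dist (ext_act x' k) (ext_act y' k) <= ext_dist x' y'.
  have [p [ep lp sp]] := gdist_walk (ext_connected x' y').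
  rewrite [X in _ <= X]/ext_dist -sp -lp -(last_map (fun z => ext_act z k)).
  rewrite -(size_map (fun z => ext_act z k) p).
  by apply: gdist_le; rewrite ext_act_path.
apply/eqP; rewrite eqn_leq le /=.
by rewrite -[X in X <= _](_ : ext_dist (ext_act (ext_act x h) h^-1)
  (ext_act (ext_act y h) h^-1) = _) ?le // -!ext_actM mulgV !ext_act1.
Qed.

Lemma ext_dist_sym x y : ext_dist x y = ext_dist y x.
Proof.
have le x' y' : ext_dist x' y' <= ext_dist y' x'.
  have [p [ep lp sp]] := gdist_walk (ext_connected y' x').
  rewrite [X in _ <= X]/ext_dist -sp.
  have -> : y' = last x' (rev (belast y' p)).
    by case: p {ep sp} lp => [|z p] //= _; rewrite ?rev_cons ?last_rcons.
  rewrite -(size_belast y' p) -size_rev; apply: gdist_le.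
  by rewrite -lp rev_path; under eq_path do rewrite ext_adj_sym.
by apply/eqP; rewrite eqn_leq !le.
Qed.

Lemma ext_dist_subadd x g m n :
  ext_dist x (ext_act x (g ^+ (m + n))) <=
    ext_dist x (ext_act x (g ^+ m)) + ext_dist x (ext_act x (g ^+ n)).
Proof.
rewrite expgnDr ext_actM addnC -[X in (_ + X)%N](ext_dist_act (g ^+ n)).
exact: ext_dist_triangle.
Qed.

Lemma ext_dist_base x y g :
  ext_dist x (ext_act x g) <= ext_dist y (ext_act y g) + 2 * ext_dist x y.
Proof.
apply: leq_trans (ext_dist_triangle y _ _) _.
rewrite mul2n -addnn addnCA leq_add2l.
apply: leq_trans (ext_dist_triangle (ext_act y g) _ _) _.
by rewrite leq_add2l ext_dist_act ext_dist_sym.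
Qed.

End ExtensionGraphTheory.

Local Open Scope classical_set_scope.
Local Open Scope ring_scope.

(* Asymptotic translation length, computed from the base vertex [x]; see
   [tau_cvg] and [tau_indep] for the existence of the limit and its
   independence of [x]. *)
Definition tau (R : realType) (G : sgraph) (x : ext_vertex G) (g : raag G) : R :=
  limn (fun n => (ext_dist x (ext_act x (g ^+ n)%g))%:R / n%:R : R).

Definition Spec (R : realType) (G : sgraph) : set R :=
  [set t | exists (x : ext_vertex G) (g : raag G), t = tau R x g].

Arguments Spec R G : clear implicits.

Lemma subadditive_cvg (R : realType) (a : nat -> nat) :
  (forall m n, a (m + n) <= a m + a n)%N ->
  cvgn (fun n => (a n)%:R / n%:R : R).
Proof.
move=> aD; pose u n : R := (a n)%:R / n%:R.
have aM q m : (a (q * m) <= q * a m + a 0)%N.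
  elim: q => [|q IH]; first by rewrite !mul0n.
  by rewrite !mulSn -addnA (leq_trans (aD _ _)) // leq_add2l.
pose S := [set u n.+1 | n in setT]; pose L := inf S.
have Slb : has_lbound S by exists 0 => _ [n _ <-]; rewrite divr_ge0.
have Sinf : has_inf S by split => //; exists (u 1%N), 0%N.
apply/cvg_ex; exists L; apply/cvgrPdist_lt => e e0.
have e2 : 0 < e / 2 by rewrite divr_gt0.
have [_ [m _ <-] um] := inf_adherent e2 Sinf; rewrite -/L in um.
pose K := (a 0%N + \sum_(i < m.+1) a i)%N.
have aK n : (a n <= n %/ m.+1 * a m.+1 + K)%N.
  rewrite {1}(divn_eq n m.+1) (leq_trans (aD _ _)) // /K addnA leq_add ?aM //.
  by rewrite (bigD1 (Ordinal (ltn_pmod n (ltn0Sn m)))) //= leq_addr.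
exists (Num.truncn (K%:R / (e / 2))).+1 => //= n /= nN.
have n0 : (0 < n)%N by apply: leq_trans nN.
have n0R : 0 < n%:R :> R by rewrite ltr0n.
have Lu : L <= u n.
  by apply: ge_inf => //; exists n.-1; rewrite ?prednK.
rewrite -/(u n) distrC ger0_norm ?subr_ge0 // ltrBlDl.
have un : u n <= u m.+1 + K%:R / n%:R.
  rewrite /u ler_pdivrMr // mulrDl divfK ?gt_eqF //.
  apply: (@le_trans _ _ (n %/ m.+1 * a m.+1 + K)%:R); first by rewrite ler_nat.
  rewrite natrD lerD2r natrM mulrAC ler_pdivlMr ?ltr0n // mulrAC -natrM.
  by rewrite mulrC ler_wpM2l // ler_nat leq_divM.
apply: le_lt_trans un _.
rewrite [X in _ < _ + X](splitr e) addrA ltrD //.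
rewrite ltr_pdivrMr // mulrC -ltr_pdivrMr //.
by apply: lt_le_trans (truncnS_gt _) _; rewrite ler_nat.
Qed.

Section TranslationLength.
Variables (R : realType) (G : sgraph) (Gconn : connected_graph G).
Implicit Types (x y : ext_vertex G) (g : raag G).

Lemma tau_cvg x g :
  (ext_dist x (ext_act x (g ^+ n)%g))%:R / n%:R @[n --> \oo] --> tau R x g.
Proof.
apply: (@subadditive_cvg R (fun n => ext_dist x (ext_act x (g ^+ n)%g))).
by move=> m n; apply: ext_dist_subadd.
Qed.

Lemma tau_indep x y g : tau R x g = tau R y g.
Proof.
have le x' y' : tau R x' g <= tau R y' g.
  have cK : (2 * ext_dist x' y')%:R / n%:R @[n --> \oo] --> (0 : R).
    rewrite -[X in _ --> X](mulr0 (2 * ext_dist x' y')%:R).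
    apply: cvgMl_tmp; apply/gtr0_cvgV0; last exact: cvgr_idn.
    by exists 1%N => // n /= n0; rewrite ltr0n.
  rewrite -[tau R y' g]addr0.
  have := @ler_cvg_to nat _ eventually_filter R _ _ _ _ (@tau_cvg x' g)
    (cvgD (@tau_cvg y' g) cK); apply.
  apply: nearW => n; rewrite [leRHS]/GRing.add /=.
  rewrite -mulrDl -natrD ler_wpM2r ?invr_ge0 //.
  by rewrite ler_nat; apply: ext_dist_base.
by apply/eqP; rewrite eq_le !le.
Qed.

End TranslationLength.

Arguments tau_cvg R {G} Gconn x g : rename.
Arguments tau_indep R {G} Gconn x y g : rename.

(* Main.v *)
(* A path of length k in the extension graph amounts to a walk v_0, ..., v_k in G
   together with a factorisation of a group element into pieces lying in the star
   subgroups <St v_0>, ..., <St v_k>. By deleting cancelling letters, the pieces can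
   be made to factor a reduced word U, so the path assigns to each letter of U a
   time, compatibly with the order between non-commuting letters. For U a power of
   a word of least length in a conjugacy class, this order forces geodesics through
   few vertices in each period: through one vertex when G is a tree, and through one
   of two vertices when G is a cycle of length at least 6 (the two ends of an edge if
   two consecutive letters commute, the two neighbours of a letter otherwise).
   Distances are then powers of a 1 x 1 or 2 x 2 min-plus matrix with integer
   entries, and the translation length is its least cycle mean, that is A11, A22 or
   (A12 + A21) / 2. Parity of walks in bipartite graphs gives the first two claims.
   For n = 2 m + 1, the word 0, m, 2 m, ... of length n has translation length
   n (2 m - 3) / 2. *)
Require Import Defs.
From mathcomp Require Import all_boot all_order all_algebra.
From mathcomp Require Import all_classical all_reals all_analysis.
From mathcomp Require Import zify lra.
Import Order.TTheory GRing.Theory Num.Theory.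

Set Implicit Arguments.
Unset Strict Implicit.
Unset Printing Implicit Defensive.

(** * Reduced words *)

(** The group is given by generators and relations, so the extension graph becomes accessible only
    once commutation of conjugates is understood. The key fact: if [a] commutes with the conjugate
    of [b] by [m], then [a] and [b] are equal or adjacent and [m] splits as a piece in the star of
    [b] times a piece in the star of [a]. The next obstacle is that the letters spent before a given
    time form an order ideal of the word, in general not a prefix. A vertex over a generator [z]
    does not see letters in the star of [z], so a path passes the vertex given by [z] and a prefix
    as soon as it visits [z] at a time when ideal and prefix differ only in such letters. The
    cutting arguments look for such a [z] and such a time. Minimal length in the conjugacy class
    makes all powers reduced, so that one cut serves in every period. *)

Section Words.
Variable G : sgraph.
Implicit Types (s t r : G * bool) (u v w x y : word G) (a b : G).

(** Decides whether commutations can bring [t] to the front of [w]; the remainder is then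
    [rem t w]. *)
Fixpoint top t w : bool :=
  if w is s :: w' then (s == t) || adj s.1 t.1 && top t w' else false.

Fixpoint reduced w : bool :=
  if w is s :: w' then ~~ top (inv_letter s) w' && reduced w' else true.

(** Left multiplication by a letter, carried out on reduced words; [act w [::]] is thus a reduced
    form of [w]. *)
Definition push t w : word G :=
  if top (inv_letter t) w then rem (inv_letter t) w else t :: w.

Definition act w x : word G := foldr push x w.

Definition proj a b w : word G := [seq s <- w | (s.1 == a) || (s.1 == b)].

(* Two words differ by commutations exactly when all their projections to pairs
   of non-commuting generators (including pairs [a], [a]) agree. *)
Definition teq u v : Prop := forall a b, ~~ adj a b -> proj a b u = proj a b v.

Lemma adj_neq a b : adj a b -> (a == b) = false.
Proof. by move=> ab; apply/eqP => e; rewrite e adj_irr in ab. Qed.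

Lemma inv_letter1 t : (inv_letter t).1 = t.1. Proof. by []. Qed.

Lemma inv_letter_neq t : (inv_letter t == t) = false.
Proof. by case: t => a []; apply/eqP => -[]. Qed.

Lemma adj_neq_trans a b t : ~~ adj a b -> adj t.1 a -> (t.1 == a) || (t.1 == b) = false.
Proof.
move=> nab ta; rewrite (adj_neq ta) /=; apply/eqP => e.
by rewrite -e adj_sym ta in nab.
Qed.

Lemma proj_excl a b s t : ~~ adj a b -> adj s.1 t.1 ->
  ((s.1 == a) || (s.1 == b)) && ((t.1 == a) || (t.1 == b)) = false.
Proof.
move=> nab st; apply/negP => /andP[/orP[]/eqP h1 h2].
  by rewrite adj_sym h1 in st; rewrite (adj_neq_trans nab st) in h2.
by rewrite adj_sym h1 in st; rewrite orbC (adj_neq_trans _ st) // adj_sym in h2.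
Qed.

(** Being movable to the front is visible in the projections, which makes [top] an invariant of
    [teq]. *)
Lemma topP t w :
  reflect (forall b, ~~ adj t.1 b -> ohead (proj t.1 b w) = Some t) (top t w).
Proof.
elim: w => [|s w IH] /=.
  by apply: ReflectF => /(_ t.1); rewrite adj_irr => /(_ isT).
have [->|ne] /= := eqVneq s t; first by apply: ReflectT => b _ /=; rewrite eqxx.
case st: (adj s.1 t.1) => /=.
  apply: (iffP IH) => h b nb; first by rewrite (adj_neq_trans nb st) h.
  by have := h b nb; rewrite (adj_neq_trans nb st).
apply: ReflectF => /(_ s.1); rewrite adj_sym st eqxx orbT => /(_ isT) /= [e].
by rewrite e eqxx in ne.
Qed.

Lemma proj_rem t w a b : top t w -> ~~ adj a b ->
  proj a b (rem t w) =
    if (t.1 == a) || (t.1 == b) then behead (proj a b w) else proj a b w.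
Proof.
move=> + nab; elim: w => //= s w IH.
have [->|ne] /= := eqVneq s t; first by move=> _; case: ifP => h; rewrite ?h.
case/andP=> st /IH ->.
by move: (proj_excl nab st); do 2!case: ifP.
Qed.

Lemma teq_sym u v : teq u v -> teq v u.
Proof. by move=> h a b /h. Qed.

Lemma teq_trans v u w : teq u v -> teq v w -> teq u w.
Proof. by move=> h1 h2 a b nab; rewrite h1 // h2. Qed.

Lemma teq_cons t u v : teq u v -> teq (t :: u) (t :: v).
Proof. by move=> h a b nab /=; rewrite -/(proj a b u) (h a b nab). Qed.

Lemma teq_top t u v : teq u v -> top t u = top t v.
Proof. by move=> h; apply/topP/topP => k b nb; rewrite -(k b nb) (h _ _ nb). Qed.

Lemma teq_rem t u v : teq u v -> top t u -> teq (rem t u) (rem t v).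
Proof.
move=> h tu a b nab; rewrite !proj_rem ?(h _ _ nab) //.
by rewrite -(teq_top t h).
Qed.

Lemma top_teq t w : top t w -> teq w (t :: rem t w).
Proof.
move=> tw a b nab /=; rewrite -/(proj a b (rem t w)) proj_rem //.
case ht: ((t.1 == a) || _) => //;
  suff : ohead (proj a b w) = Some t by case: (proj a b w) => //= ? ? [->].
case/orP: ht => /eqP e; move/topP: tw; rewrite e => h; first exact: h.
have -> : proj a b w = proj b a w by apply: eq_filter => s /=; rewrite orbC.
by apply: h; rewrite adj_sym.
Qed.

Lemma top_rem t r w : top t w -> adj t.1 r.1 -> top r (rem t w) = top r w.
Proof.
move=> tw tr; apply/topP/topP => h b nb; have := h b nb;
  by rewrite proj_rem // (adj_neq_trans nb tr).
Qed.

Lemma top_cons t r w : adj t.1 r.1 -> top r (t :: w) = top r w.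
Proof. by move=> tr /=; rewrite tr /=; case: eqP => // e; rewrite e adj_irr in tr. Qed.

Lemma red_rem t w : reduced w -> top t w -> reduced (rem t w).
Proof.
elim: w => //= s w IH /andP[ns rw]; have [->//|ne] /= := eqVneq s t.
by case/andP=> st tw; rewrite IH // top_rem ?ns // adj_sym.
Qed.

Lemma red_top t w : reduced w -> top t w -> ~~ top (inv_letter t) (rem t w).
Proof.
elim: w => //= s w IH /andP[ns rw]; have [<-//|ne] /= := eqVneq s t.
case/andP=> st tw; rewrite negb_or negb_and IH // orbT andbT.
by apply/eqP => e; rewrite e adj_irr in st.
Qed.

Lemma red_push t w : reduced w -> reduced (push t w).
Proof.
by move=> rw; rewrite /push; case: ifP => h; [apply: red_rem|rewrite /= h].
Qed.

Lemma red_act u x : reduced x -> reduced (act u x).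
Proof. by move=> rx; elim: u => //= t u IH; apply: red_push. Qed.

Lemma push_teq t u v : teq u v -> teq (push t u) (push t v).
Proof.
move=> h; rewrite /push -(teq_top _ h); case: ifP => k; first exact: teq_rem.
exact: teq_cons.
Qed.

Lemma act_teq w u v : teq u v -> teq (act w u) (act w v).
Proof. by move=> h; elim: w => //= t w IH; apply: push_teq. Qed.

Lemma pushK t u : reduced u -> teq (push (inv_letter t) (push t u)) u.
Proof.
move=> ru; rewrite {2}/push; case: ifP => h.
  rewrite /push inv_letterK.
  by have /negbTE := red_top ru h; rewrite inv_letterK => ->; apply/teq_sym/top_teq.
by rewrite /push inv_letterK /= eqxx.
Qed.

Lemma top_push t r u : adj t.1 r.1 -> top r (push t u) = top r u.
Proof.
by move=> tr; rewrite /push; case: ifP => h; [apply: top_rem|apply: top_cons].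
Qed.

Lemma pushC s t u : adj s.1 t.1 -> teq (push s (push t u)) (push t (push s u)).
Proof.
move=> st; have ts : adj t.1 s.1 by rewrite adj_sym.
have [hs ht] : top (inv_letter s) (push t u) = top (inv_letter s) u /\
   top (inv_letter t) (push s u) = top (inv_letter t) u by split; apply: top_push.
move=> a b nab; rewrite {1}/push hs [X in _ = proj _ _ X]/push ht.
have ex := proj_excl nab st.
case hs' : (top (inv_letter s) u); case ht' : (top (inv_letter t) u);
  rewrite /push ?hs' ?ht'.
- rewrite !proj_rem ?top_rem // !inv_letter1.
  by move: ex; do 2!case: ifP.
- rewrite proj_rem ?top_cons // !inv_letter1 /= -!/(proj a b _) proj_rem // inv_letter1.
  by move: ex; do 2!case: ifP.
- rewrite [RHS]proj_rem ?top_cons // !inv_letter1 /= -!/(proj a b _) proj_rem //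
  inv_letter1.
  by move: ex; do 2!case: ifP.
- by move: ex => /=; do 2!case: ifP.
Qed.

(** Van der Waerden's method: letters act on reduced words up to [teq] and this action satisfies the
    defining relations. Applied to the empty word it gives uniqueness of reduced forms up to
    commutation. *)
Lemma raag_eq_act u v : raag_eq u v -> forall x, reduced x -> teq (act u x) (act v x).
Proof.
elim=> {u v} [w|u v _ IH|u v w _ IH1 _ IH2|u u' v v' _ IH1 _ IH2|a b|a b ab] x rx //.
- exact/teq_sym/IH.
- exact: teq_trans (IH1 x rx) (IH2 x rx).
- rewrite /act !foldr_cat -!/(act _ _); apply: teq_trans (act_teq _ (IH2 x rx)) _.
  by apply: IH1; apply: red_act.
- by have /= := pushK (a, ~~ b) rx; rewrite /inv_letter /= negbK.
- exact: (@pushC (a, true) (b, true)).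
Qed.

Lemma act_red w : reduced w -> act w [::] = w.
Proof. by elim: w => //= s w IH /andP[ns /IH ->]; rewrite /push (negbTE ns). Qed.

Lemma raag_eq_teq u v : raag_eq u v -> reduced u -> reduced v -> teq u v.
Proof.
by move=> /raag_eq_act /(_ [::] isT) + ru rv; rewrite !act_red.
Qed.

Lemma teq_nil u : teq u [::] -> u = [::].
Proof.
by case: u => // s u /(_ s.1 s.1); rewrite adj_irr /= eqxx => /(_ isT).
Qed.

Lemma top_mem t u : top t u -> t \in u.
Proof.
elim: u => //= s u IH; rewrite in_cons => /orP[/eqP->|/andP[_ /IH ->]];
  by rewrite ?eqxx ?orbT.
Qed.

Lemma teq_perm u v : teq u v -> perm_eq u v.
Proof.
elim: u v => [|t u IH] v h; first by rewrite (teq_nil (teq_sym h)).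
have tv : top t v by rewrite -(teq_top _ h) /= eqxx.
rewrite perm_sym (perm_trans (perm_to_rem (top_mem tv))) // perm_cons perm_sym.
apply: IH; have := @teq_rem t _ _ h; rewrite /= eqxx /=; exact.
Qed.

Lemma rem_subseq_map (A : eqType) (f : A -> G * bool) t (p : seq A) :
  exists2 q, subseq q p & map f q = rem t (map f p).
Proof.
elim: p => [|x p [q sq eq]] /=; first by exists [::].
case: eqP => e; first by exists p => //; apply: subseq_cons.
by exists (x :: q); rewrite /= ?eqxx ?eq.
Qed.

(** Reduction only deletes letters. The labels in [A] record which occurrences survive, so that time
    tags can be carried along. *)
Lemma act_subseq (A : eqType) (f : A -> G * bool) (p : seq A) :
  exists2 q, subseq q p & map f q = act (map f p) [::].
Proof.
elim: p => [|x p [q sq eq]]; first by exists [::].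
rewrite [map f (x :: p)]/= [act (_ :: _) _]/= -eq /push; case: ifP => h.
  have [q' sq' eq'] := rem_subseq_map f (inv_letter (f x)) q.
  by exists q' => //; apply: subseq_trans sq' (subseq_trans sq (subseq_cons p x)).
by exists (x :: q) => //=; rewrite eqxx.
Qed.

Lemma raag_eq_size_red u v : raag_eq u v -> reduced u -> size u = size v -> reduced v.
Proof.
move=> h ru e; have [q sq eq] := act_subseq id v; rewrite !map_id in eq.
have := teq_perm (@raag_eq_act _ _ h [::] isT); rewrite act_red // -eq => /perm_size e'.
have/eqP eqv : q == v by rewrite -(size_subseq_leqif sq) -e' e.
by rewrite -eqv eq red_act.
Qed.

Lemma raag_eq_size_teq u v : raag_eq u v -> reduced u -> size u = size v -> teq u v.
Proof. by move=> h ru e; apply: raag_eq_teq => //; apply: raag_eq_size_red e. Qed.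

Lemma raag_eq_subseq (A : eqType) (f : A -> G * bool) (p : seq A) u :
  raag_eq u (map f p) -> reduced u ->
  exists2 q, subseq q p & teq u (map f q).
Proof.
move=> h ru; have [q sq eq] := act_subseq f p; exists q => //.
by rewrite eq -(act_red ru); apply: raag_eq_act.
Qed.

Lemma top_cat t u v :
  top t (u ++ v) = top t u || all (fun s => adj s.1 t.1) u && top t v.
Proof.
elim: u => //= s u ->; case: eqP => //= _.
by case: (adj s.1 t.1).
Qed.

Lemma red_cat u v : reduced u -> reduced v ->
  (forall t, top t (rev u) -> ~~ top (inv_letter t) v) -> reduced (u ++ v).
Proof.
elim: u => //= s u IH /andP[ns ru] rv h.
rewrite top_cat negb_or ns negb_and /=; apply/andP; split; last first.
  apply: IH => // t tu; apply: h; rewrite rev_cons -cats1 top_cat tu //.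
case: (boolP (all _ _)) => //= al; apply: h.
rewrite rev_cons -cats1 top_cat all_rev; apply/orP; right.
by rewrite /= eqxx /= andbT; apply: sub_all al => r.
Qed.

Lemma top_map_inv t u : top t (map (@inv_letter G) u) = top (inv_letter t) u.
Proof.
elim: u => //= s u ->; congr orb.
by rewrite -(inj_eq (inv_inj (@inv_letterK G))) inv_letterK.
Qed.

Lemma top_rev_inv t u : top t (rev (inv_word u)) = top (inv_letter t) u.
Proof. by rewrite /inv_word revK top_map_inv. Qed.

Lemma red_inv u : reduced u -> reduced (inv_word u).
Proof.
elim: u => //= s u IH /andP[ns ru].
rewrite /inv_word /= rev_cons -cats1; apply: red_cat => //; first exact: IH.
move=> t; rewrite -/(inv_word u) top_rev_inv => tu /=; rewrite andbF orbF.
apply: contra ns => /eqP/(can_inj (@inv_letterK G)) ->; rewrite //.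
Qed.

Lemma nred_split u : ~~ reduced u -> exists x t y z,
  u = x ++ t :: y ++ inv_letter t :: z /\ all (fun s => adj s.1 t.1) y.
Proof.
elim: u => //= s u IH; rewrite negb_and negbK => /orP[|/IH]; last first.
  by move=> [x [t [y [z [-> h]]]]]; exists (s :: x), t, y, z.
move=> h; exists [::], s => /=.
elim: u h {IH} => //= r u IH /orP[/eqP ->|/andP[ra /IH [y [z [[->] h]]]]].
  by exists [::], u.
by exists (r :: y), z => /=; rewrite ra h.
Qed.

End Words.

(** * Stars and adjacency in the extension graph *)

Section Evaluation.
Variable G : sgraph.
Local Open Scope group_scope.
Implicit Types (s t r : G * bool) (u v w x y : word G) (a b : G) (P Q R : raag G).

Definition ev w : raag G := (\pi_(raag G) w)%qT.

Lemma ev_cat u v : ev (u ++ v) = ev u * ev v.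
Proof. by rewrite [RHS]raag_mulE. Qed.

Lemma ev_nil : ev [::] = 1. Proof. by []. Qed.

Lemma ev_cons t u : ev (t :: u) = ev [:: t] * ev u.
Proof. exact: (ev_cat [:: t]). Qed.

Lemma ev_inv w : ev (inv_word w) = (ev w)^-1.
Proof. by rewrite [RHS]raag_invE. Qed.

Lemma evP u v : raag_eq u v <-> ev u = ev v.
Proof. by split => [/raag_piP/eqP|/eqP/raag_piP]. Qed.

Lemma ev_surj P : exists w, P = ev w.
Proof. by exists (repr P); rewrite /ev reprK. Qed.

Lemma ev_inv_letter t : ev [:: inv_letter t] = (ev [:: t])^-1.
Proof. by rewrite -ev_inv. Qed.

Lemma ev_letter a (e : bool) :
  ev [:: (a, e)] = if e then raag_gen a else (raag_gen a)^-1.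
Proof. by case: e => //; rewrite -ev_inv. Qed.

Lemma commute_letter s t : adj s.1 t.1 -> commute (ev [:: s]) (ev [:: t]).
Proof.
case: s t => [a e] [b f] /= /raag_gen_comm ab; rewrite !ev_letter.
case: e; case: f => //; first exact: commuteV.
  exact/commute_sym/commuteV/commute_sym.
exact/commuteV/commute_sym/commuteV/commute_sym.
Qed.

Definition in_star a s := (s.1 == a) || adj a s.1.

Lemma in_star_inv a s : in_star a (inv_letter s) = in_star a s.
Proof. by []. Qed.

Lemma commute_star a w : all (in_star a) w -> commute (raag_gen a) (ev w).
Proof.
elim: w => [_|s w IH /= /andP[sa /IH]]; first exact: commute1.
rewrite ev_cons => h; apply: commuteM => //; case/orP: sa => [/eqP sa|sa].
  case: s sa => b e /= ->; rewrite ev_letter; case: e => //; exact: commuteV.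
exact: (@commute_letter (a, true)).
Qed.

Lemma commute_conj P Q : commute P Q -> P ^ Q = P.
Proof. by move=> h; rewrite conjgE h mulKg. Qed.

Lemma conj_star a w : all (in_star a) w -> raag_gen a ^ ev w = raag_gen a.
Proof. by move=> /commute_star/commute_conj. Qed.

Lemma star_inv a w : all (in_star a) (inv_word w) = all (in_star a) w.
Proof. by rewrite all_rev all_map; apply: eq_all => s. Qed.

Lemma conj_starV a w : all (in_star a) w -> raag_gen a ^ (ev w)^-1 = raag_gen a.
Proof. by rewrite -star_inv -ev_inv => /conj_star. Qed.

Lemma ev_top t w : top t w -> ev w = ev (t :: rem t w).
Proof.
elim: w => //= s w IH; case: eqP => [->//|_ /= /andP[st /IH e]].
rewrite ev_cons e [in RHS]ev_cons ![ev (_ :: rem _ _)]ev_cons !mulgA.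
by congr (_ * _); apply: commute_letter.
Qed.

Lemma ev_push t w : ev (push t w) = ev [:: t] * ev w.
Proof.
rewrite /push; case: ifP => [h|_]; last by rewrite ev_cons.
by rewrite (ev_top h) [ev (_ :: rem _ _)]ev_cons ev_inv_letter mulVKg.
Qed.

Lemma ev_act w x : ev (act w x) = ev w * ev x.
Proof.
elim: w => [|t w IH] /=; first by rewrite ev_nil mul1g.
by rewrite ev_push -/(act w x) IH mulgA -ev_cons.
Qed.

Lemma ev_nf w : ev (act w [::]) = ev w.
Proof. by rewrite ev_act ev_nil mulg1. Qed.

Lemma size_nf w : ~~ reduced w -> size (act w [::]) < size w.
Proof.
move=> nr; have [q sq eq] := act_subseq id w; rewrite !map_id in eq.
rewrite -eq ltn_neqAle size_subseq // andbT.
apply: contra nr => /eqP e; have/eqP <- : q == w by rewrite -(size_subseq_leqif sq) e.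
by rewrite eq; apply: red_act.
Qed.

Lemma raag_gen_inj : injective (@raag_gen G).
Proof.
move=> a b /evP h; have := raag_eq_teq h isT isT.
by move=> /teq_perm/perm_mem/(_ (a, true)); rewrite !inE eqxx => /esym/eqP[].
Qed.

(** Letters of the star of [b] at the front of [m] and of the star of [a] at its end are split off
    by induction on the length. When none is left, [m^-1 b m] is reduced as written, and comparing
    the two sides of the commutation as reduced words puts all of [m] in the star of [a]. *)
Lemma comm_conj_gen a b m :
  commute (raag_gen a) (raag_gen b ^ ev m) ->
  (a = b \/ adj a b) /\ exists x y,
    [/\ all (in_star b) x, all (in_star a) y & ev m = ev x * ev y].
Proof.
elim: (size m).+1 {-2}m (ltnSn (size m)) => // {m} k IH m; rewrite ltnS => mk cm.
case: (boolP (reduced m)) => [rm|/size_nf nr]; last first.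
  by rewrite -ev_nf; apply: IH; rewrite ?ev_nf // (leq_trans nr).
case: (boolP (has (fun t => top t m && in_star b t) m)) => [/hasP[t tm /andP[tt
  tb]]|/hasPn nb].
  have e : ev m = ev [:: t] * ev (rem t m) by rewrite -ev_cons -ev_top.
  have [||ab [x [y [bx ay xy]]]] := IH (rem t m).
  - by rewrite size_rem // (leq_trans _ mk) // prednK //; case: (m) tm.
  - have st : all (in_star b) [:: t] by rewrite /= tb.
    by move: cm; rewrite e conjgM (conj_star st).
  split => //; exists (t :: x), y; split; rewrite /= ?tb //.
  by rewrite e xy mulgA -ev_cons.
case: (boolP (has (fun t => top t (inv_word m) && in_star a t) (inv_word m)))
    => [/hasP[t tm /andP[tt ta]]|/hasPn na].
  have e : ev m = ev (inv_word (rem t (inv_word m))) * ev [:: inv_letter t].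
    by apply: invg_inj; rewrite invgM ev_inv_letter invgK -!ev_inv inv_wordK -ev_cons
      -ev_top.
  have [||ab [x [y [bx ay xy]]]] := IH (inv_word (rem t (inv_word m))).
  - rewrite size_rev size_map size_rem // size_rev size_map (leq_trans _ mk) // prednK //.
    by case: (m) tm.
  - have e' : raag_gen a ^ ev [:: inv_letter t] =
    raag_gen a by rewrite conj_star //= andbT in_star_inv.
    move: cm; rewrite -{1}e' e conjgM /commute -!conjMg => /conjg_inj; exact.
  split => //; exists x, (y ++ [:: inv_letter t]); split => //.
    by rewrite all_cat ay /= in_star_inv ta.
  by rewrite {1}e xy ev_cat mulgA.
have mnb t : top t m -> ~~ in_star b t.
  by move=> tm; have := nb _ (top_mem tm); rewrite tm.
have mna t : top t (inv_word m) -> ~~ in_star a t.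
  by move=> tm; have := na _ (top_mem tm); rewrite tm.
pose Y := inv_word m ++ (b, true) :: m.
have evY : ev Y = raag_gen b ^ ev m by rewrite ev_cat ev_cons ev_inv -conjgE.
have rY : reduced Y.
  apply: red_cat; first exact: red_inv.
    rewrite /= rm andbT; apply/negP => /mnb.
    by rewrite /in_star eqxx.
  move=> t; rewrite top_rev_inv => h; have := mnb _ h;
    rewrite /in_star negb_or => /andP[n1 n2].
  rewrite /= (negbTE n2) orbF; apply: contra n1 => /eqP <-; exact: eqxx.
(* The sign is chosen so that the new letter does not cancel against a letter over [a] in [Y]. *)
have [e re] : exists e, reduced ((a, e) :: Y).
  case h : (top (a, true) Y); [exists true|exists false];
    rewrite /= rY andbT /inv_letter /= ?h //.
  have : proj a a Y = proj a a Y by [].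
  move/topP: h => /(_ a); rewrite adj_irr => /(_ isT) h1 _.
  by apply/negP => /topP /(_ a); rewrite adj_irr => /(_ isT); rewrite h1.
have : teq ((a, e) :: Y) (Y ++ [:: (a, e)]).
  apply: raag_eq_size_teq => //; last by rewrite size_cat addn1.
  apply/evP; rewrite ev_cons ev_cat evY ev_letter.
  case: (e) => //; exact/commute_sym/commuteV/commute_sym.
(* [(a, e)] leads the left side, so on the right it can be brought to the front from inside [Y] or
   commutes past all of [Y]. *)
move=> /(teq_top (a, e)); rewrite [top _ (_ :: Y)]/= eqxx => /esym.
rewrite top_cat => /orP[|/andP[]]; last first.
  rewrite all_cat /= => /and3P[_ ba al] _; split; first by right; rewrite adj_sym.
  exists [::], m; split => //; last by rewrite ev_nil mul1g.
  by apply: sub_all al => s /=; rewrite /in_star adj_sym => ->; rewrite orbT.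
rewrite top_cat => /orP[/mna|/andP[al]]; first by rewrite /in_star eqxx.
rewrite /= => /orP[/eqP[ab _]|/andP[_ /top_mem]]; last first.
  move=> am; move/allP: al => /(_ (inv_letter (a, e))).
  by rewrite adj_irr mem_rev map_f // => /(_ isT).
split; first by left.
exists [::], m; split => //; last by rewrite ev_nil mul1g.
move: al; rewrite all_rev all_map; apply: sub_all => s /=.
by rewrite /in_star adj_sym => ->; rewrite orbT.
Qed.

(* The action being on the right, the inverse makes a path of the extension graph
   read off a word from left to right. *)
Definition vtx a P : ext_vertex G := ext_act (ext_gen a) P^-1.

Lemma vtx_surj z : exists a P, z = vtx a P.
Proof.
by have [a [P ->]] := ext_genE z; exists a, P^-1; rewrite /vtx invgK.
Qed.

Lemma vtx_act a P Q : ext_act (vtx a P) Q^-1 = vtx a (Q * P).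
Proof. by rewrite /vtx -ext_actM invgM. Qed.

Lemma vtx1 a : vtx a 1 = ext_gen a.
Proof. by rewrite /vtx invg1 ext_act1. Qed.

Lemma vtx_star a P w : all (in_star a) w -> vtx a (P * ev w) = vtx a P.
Proof. by move=> h; apply: val_inj; rewrite /= invgM conjgM conj_starV. Qed.

Lemma vtx_eqP a b P R : vtx a P = vtx b R ->
  a = b /\ exists2 f, all (in_star a) f & R = P * ev f.
Proof.
move=> /(congr1 (fun z => val z ^ P)); rewrite /= conjgKV -conjgM.
have [m em] := ev_surj (R^-1 * P); rewrite em => e.
have [|ab [x [y [bx ay xy]]]] := @comm_conj_gen a b m; first by rewrite -e.
case: ab => ab.
  split => //; exists (inv_word (x ++ y)).
    by rewrite star_inv all_cat ay -?ab // {1}ab bx.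
  rewrite ev_inv ev_cat -xy -em invgM invgK mulVKg //.
move: e; rewrite xy conjgM conj_star // => /(congr1 (fun z => z ^ (ev y)^-1)).
rewrite conjgK conj_starV // => /raag_gen_inj e.
by rewrite e adj_irr in ab.
Qed.

(** A step to a neighbour corrects the group element inside the star of the current generator and
    then changes the generator. *)
Lemma vtx_adjP a b P R : ext_adj (vtx a P) (vtx b R) ->
  adj a b /\ exists2 f, all (in_star a) f & vtx b R = vtx b (P * ev f).
Proof.
rewrite /ext_adj /= => /andP[ne /eqP c].
have [m em] := ev_surj (R^-1 * P).
have [|ab [x [y [bx ay xy]]]] := @comm_conj_gen a b m.
  move: c => /(congr1 (fun z => z ^ P)).
  rewrite !(conjMg (raag_gen _ ^ _) (raag_gen _ ^ _)) -!conjgM mulVg conjg1 em.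
  exact.
have eR : R = P * ev (inv_word y) * ev (inv_word x).
  by rewrite -mulgA -ev_cat -[inv_word y ++ _](_ :
    inv_word (x ++ y) = _) ?ev_inv ?ev_cat -?xy -?em ?invgM ?invgK ?mulVKg // /inv_word
      map_cat rev_cat.
have eb : vtx b R = vtx b (P * ev (inv_word y)) by rewrite eR vtx_star // star_inv.
split; last by exists (inv_word y); rewrite ?star_inv.
case: ab => // ab; move: ne; rewrite eb -ab vtx_star ?star_inv //.
by rewrite eqxx.
Qed.

Lemma vtx_adj a b P : adj a b -> ext_adj (vtx a P) (vtx b P).
Proof.
move=> ab; rewrite ext_act_adj /ext_adj; apply/andP; split; last first.
  exact/eqP/raag_gen_comm.
apply/eqP => /(congr1 val) /raag_gen_inj e; by rewrite e adj_irr in ab.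
Qed.

End Evaluation.

(** * Paths as schedules of reduced words *)

Section Schedules.
Variable G : sgraph.
Local Open Scope group_scope.
Implicit Types (u w : word G) (a b : G) (P Q R : raag G).

Lemma path_factor p a P b Q :
  path ext_adj (vtx a P) p -> last (vtx a P) p = vtx b Q ->
  exists vs (tw : seq ((G * bool) * nat)),
    [/\ size vs = size p, path adj a vs, last a vs = b,
        pairwise (fun x y => x.2 <= y.2) tw &
        all (fun x => in_star (nth a (a :: vs) x.2) x.1 && (x.2 <= size p)) tw
        /\ Q = P * ev (map fst tw)].
Proof.
elim: p a P => [|z p IH] a P /=.
  move=> _ /vtx_eqP[-> [f af ->]]; exists [::], [seq (s, 0) | s <- f]; split => //=.
    by rewrite pairwise_map; elim: f {af} => //= s f ->; rewrite andbT; apply/allP.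
  split; last by rewrite -map_comp map_id.
  by rewrite all_map; apply: sub_all af => s /= ->.
have [c [R ->]] := vtx_surj z.
case/andP=> /vtx_adjP[ac [f af e]]; rewrite e => hp hl.
have [vs [tw [sz pt lst pw [al eQ]]]] := IH _ _ hp hl.
exists (c :: vs), ([seq (s, 0) | s <- f] ++ [seq (x.1, x.2.+1) | x <- tw]).
split; rewrite /= ?sz ?ac ?pt //.
  rewrite pairwise_cat !pairwise_map; apply/and3P; split.
  - by apply/allrelP => ? ? /mapP[? _ ->].
  - by elim: f {af e hp hl eQ} => //= s f ->; rewrite andbT; apply/allP.
  - by apply: sub_pairwise pw => x y /=.
split; last by rewrite map_cat -!map_comp map_id ev_cat mulgA.
rewrite all_cat !all_map; apply/andP; split; first by apply: sub_all af => s /= ->.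
apply: sub_all al => x /= /andP[h1 h2]; rewrite ltnS h2 andbT.
by rewrite (set_nth_default c) //= ltnS sz.
Qed.

Lemma top_split (A : eqType) (f : A -> G * bool) t (w : seq A) :
  top t (map f w) -> exists (b : seq A) x c,
    [/\ w = b ++ x :: c, f x = t, all (fun y => adj (f y).1 t.1) b
      & rem t (map f w) = map f (b ++ c)].
Proof.
elim: w => //= y w IH; case: eqP => [e _|_ /= /andP[yt /IH]].
  by exists [::], y, w.
move=> [b [x [c [ew ex al er]]]]; exists (y :: b), x, c; split => //=.
- by rewrite ew.
- by rewrite yt al.
- by rewrite er.
Qed.

(** Commutations keep the relative order of non-commuting letters, so tags that increase along one
    word still respect that order in the other. *)
Lemma teq_tags u (tw : seq ((G * bool) * nat)) :
  teq u (map fst tw) -> pairwise (fun x y => x.2 <= y.2) tw ->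
  exists tu, [/\ map fst tu = u, perm_eq tu tw &
    pairwise (fun x y => adj x.1.1 y.1.1 || (x.2 <= y.2)) tu].
Proof.
elim: u tw => [|t u IH] tw e pw.
  by move/teq_sym/teq_nil: e => e; exists [::]; split => //; case: tw e {pw}.
have tt : top t (map fst tw) by rewrite -(teq_top _ e) /= eqxx.
have [b [x [c [ew ex al er]]]] := top_split tt.
move: pw; rewrite ew pairwise_cat /= => /and3P[/allrelP pbc pb /andP[/allP px pc]].
have [||tu [eu pu hu]] := IH (b ++ c).
- by rewrite -er; have := @teq_rem G t _ _ e; rewrite /= eqxx; apply.
- rewrite pairwise_cat pb pc !andbT; apply/allrelP => y z yb zc.
  by apply: pbc => //; rewrite inE zc orbT.
exists (x :: tu); split; rewrite /= ?eu ?ex //.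
  by rewrite perm_sym -cat1s perm_catCA /= perm_cons perm_sym.
rewrite hu andbT; apply/allP => y; rewrite (perm_mem pu) mem_cat => /orP[yb|yc].
  by rewrite adj_sym (allP al).
by rewrite px ?orbT.
Qed.

(* A walk [v] of length [k] in [G] spending the letters of the word [l] of length
   [n], letter [i] at time [c i], encodes a path of length [k] in the extension
   graph: see [sched_vtx]. *)
Definition schedule (n : nat) (l : nat -> G * bool) (k : nat) (v : nat -> G)
    (c : nat -> nat) : Prop :=
  [/\ forall t, t < k -> adj (v t) (v t.+1),
      forall i, i < n -> c i <= k,
      forall i, i < n -> in_star (v (c i)) (l i) &
      forall i i', i < i' -> i' < n -> ~~ adj (l i).1 (l i').1 -> c i <= c i'].

Lemma path_schedule n (l : nat -> G * bool) p a b :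
  reduced (mkseq l n) -> path ext_adj (ext_gen a) p ->
  last (ext_gen a) p = vtx b (ev (mkseq l n)) ->
  exists v c, [/\ schedule n l (size p) v c, v 0 = a & v (size p) = b].
Proof.
rewrite -vtx1 => rl hp hl; have [vs [tw [sz pt lst pw [al eQ]]]] := path_factor hp hl.
rewrite mul1g in eQ; have [q sq tq] := raag_eq_subseq ((evP _ _).2 eQ) rl.
have [tu [eu pu hu]] := teq_tags tq (subseq_pairwise sq pw).
have su : size tu = n by rewrite -(size_map fst) eu size_mkseq.
have inu i : i < n -> nth (l 0, 0) tu i \in tw.
  by move=> ni; apply: (mem_subseq sq); rewrite -(perm_mem pu) mem_nth // su.
have lu i : i < n -> l i = (nth (l 0, 0) tu i).1.
  by move=> ni; rewrite -(nth_map _ (l 0)) ?su // eu nth_mkseq.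
exists (nth a (a :: vs)), (fun i => (nth (l 0, 0) tu i).2); split => //.
  split => [t tk|i ni|i ni|i i' ii ni nadj].
  - by move/(pathP a): pt; apply; rewrite sz.
  - by have /andP[] := allP al _ (inu i ni).
  - by rewrite (lu i ni); have /andP[] := allP al _ (inu i ni).
  - have ni' : i < n by apply: ltn_trans ni.
    move/(pairwiseP (l 0, 0)): hu => /(_ i i'); rewrite !inE su => /(_ ni' ni ii).
    by rewrite -!lu // (negbTE nadj).
by rewrite -lst -sz; case: (vs) => //= z vs'; rewrite (last_nth a).
Qed.

Definition subword (l : nat -> G * bool) (n : nat) (D : pred nat) : word G :=
  [seq l i | i <- iota 0 n & D i].

(** Order ideals of the heap of the word: sets of positions whose letters can be shuffled to the
    front. *)
Definition ideal (l : nat -> G * bool) (n : nat) (D : pred nat) : Prop :=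
  forall i i', i < i' -> i' < n -> ~~ adj (l i).1 (l i').1 -> D i' -> D i.

Lemma subwordS l n D :
  subword l n.+1 D = subword l n D ++ (if D n then [:: l n] else [::]).
Proof. by rewrite /subword -addn1 iotaD filter_cat map_cat /= add0n; case: (D n). Qed.

Lemma eq_subword l n (D D' : pred nat) :
  (forall i, i < n -> D i = D' i) -> subword l n D = subword l n D'.
Proof.
by move=> h; congr map; apply: eq_in_filter => i; rewrite mem_iota add0n => /h.
Qed.

Lemma subword_prefix l n p : p <= n -> subword l n (fun i => i < p) = mkseq l p.
Proof.
move=> pn; rewrite /subword /mkseq; congr map.
rewrite -(subnKC pn) iotaD filter_cat add0n (@eq_in_filter _ _ predT); last first.
  by move=> i; rewrite mem_iota add0n /= => ->.
rewrite filter_predT (@eq_in_filter _ _ pred0) ?filter_pred0 ?cats0 // => i.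
by rewrite mem_iota leqNgt => /andP[/negbTE].
Qed.

Lemma commute_letters w (t : G * bool) :
  all (fun s => adj s.1 t.1) w -> commute (ev [:: t]) (ev w).
Proof.
elim: w => [_|s w IH /= /andP[st /IH h]]; first exact: commute1.
by rewrite [ev (s :: w)]ev_cons; apply: commuteM => //; apply: commute_letter;
  rewrite adj_sym.
Qed.

Lemma ideal_split l n (D D' : pred nat) :
  ideal l n D -> (forall i, i < n -> D i -> D' i) ->
  ev (subword l n D') =
    ev (subword l n D) * ev (subword l n (fun i => D' i && ~~ D i)).
Proof.
elim: n => [|n IH] idD sub; first by rewrite mulg1.
rewrite !subwordS !ev_cat IH; last 2 first.
- by move=> i i' ii ni; apply: idD => //; apply: ltnW.
- by move=> i ni; apply: sub; apply: ltnW.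
case Dn: (D n); rewrite ?andbF ?andbT; last by rewrite !ev_nil !mulg1 mulgA.
rewrite (sub n) // ev_nil mulg1 -!mulgA; congr (_ * _); apply/commute_sym.
apply: commute_letters; rewrite all_map; apply/allP => i.
rewrite mem_filter mem_iota add0n => /andP[/andP[_ nD] ni] /=.
apply: contraNT nD => nadj; exact: idD Dn.
Qed.

(** Both sides are compared with the intersection, again an ideal: what it lacks follows as a factor
    in the star of [a]. *)
Lemma vtx_ideal l n (D D' : pred nat) a : ideal l n D -> ideal l n D' ->
  (forall i, i < n -> D i != D' i -> in_star a (l i)) ->
  vtx a (ev (subword l n D)) = vtx a (ev (subword l n D')).
Proof.
move=> idD idD' h; pose E := [pred i | D i && D' i].
have idE : ideal l n E.
  move=> i i' ii ni nadj /andP[h1 h2]; apply/andP.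
  by split; [apply: idD h1|apply: idD' h2].
have main (D0 : pred nat) : (forall i, i < n -> E i -> D0 i) -> (forall i, i < n ->
  D0 i -> ~~ E i -> in_star a (l i)) ->
    vtx a (ev (subword l n D0)) = vtx a (ev (subword l n E)).
  move=> sub st; rewrite (ideal_split idE sub) vtx_star // all_map.
  apply/allP => i; rewrite mem_filter mem_iota add0n => /andP[/andP[h1 h2] ni].
  exact: st.
rewrite !main //=.
- by move=> i _ /andP[].
- by move=> i ni Di; rewrite Di andbT => nD; apply: h; rewrite // Di; case: (D i) nD.
- by move=> i _ /andP[].
- by move=> i ni Di; rewrite Di /= => nD; apply: h; rewrite // Di; case: (D' i) nD.
Qed.

Lemma ideal_prefix l n p : ideal l n (fun i => i < p).
Proof. by move=> i i' ii _ _; apply: ltn_trans. Qed.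

Section OneSchedule.
Hypothesis Gconn : connected_graph G.
Variables (n : nat) (l : nat -> G * bool) (k : nat) (v : nat -> G) (c : nat -> nat).
Hypothesis S : schedule n l k v c.

Definition sched_vtx t := vtx (v t) (ev (subword l n (fun i => c i < t))).

Lemma sched_ideal t : ideal l n (fun i => c i < t).
Proof. by case: S => _ _ _ h i i' ii ni nadj; apply: leq_ltn_trans; apply: h. Qed.

Lemma ext_dist_adj (x y : ext_vertex G) : ext_adj x y -> ext_dist x y <= 1.
Proof. by move=> xy; have := @gdist_le _ _ x [:: y]; apply; rewrite /= xy. Qed.

Lemma ext_dist0 (x : ext_vertex G) : ext_dist x x = 0.
Proof. by apply/eqP; rewrite -leqn0; have := @gdist_le _ ext_adj x [::]; apply. Qed.

(** Letters spent at time [t] lie in the star of [v t], so it is immaterial whether they already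
    count as spent. *)
Lemma sched_vtxS t : t <= k -> sched_vtx t =
  vtx (v t) (ev (subword l n (fun i => c i < t.+1))).
Proof.
move=> tk; apply: vtx_ideal; [exact: sched_ideal|exact: sched_ideal|] => i ni ne.
have <- : c i = t by move: ne; case: ltnP; case: ltnP; lia.
by case: S => _ _ h _; apply: h.
Qed.

Lemma sched_dist s t : s <= t <= k -> ext_dist (sched_vtx s) (sched_vtx t) <= t - s.
Proof.
elim: t => [|t IH]; first by rewrite leqn0 => /andP[/eqP -> _]; rewrite ext_dist0.
rewrite leq_eqVlt => /andP[/orP[/eqP ->|st] tk]; first by rewrite ext_dist0.
apply: leq_trans (ext_dist_triangle Gconn (sched_vtx t) _ _) _.
rewrite subSn // -[X in _ <= X]addn1 leq_add //; first by apply: IH;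
  rewrite -ltnS st ltnW.
apply: ext_dist_adj; rewrite sched_vtxS; last exact: ltnW.
by apply: vtx_adj; case: S => h _ _ _; apply: h.
Qed.

Lemma sched_start : sched_vtx 0 = ext_gen (v 0).
Proof.
rewrite /sched_vtx (@eq_subword _ _ _ pred0) // /subword.
by rewrite (eq_filter (a2 := pred0)) // filter_pred0 /= ev_nil vtx1.
Qed.

Lemma sched_end : sched_vtx k = vtx (v k) (ev (mkseq l n)).
Proof.
rewrite -(@subword_prefix l n n) // sched_vtxS //; congr (vtx _ (ev _)).
by apply: eq_subword => i ni; case: S => _ h _ _; rewrite ni ltnS h.
Qed.

Lemma sched_geodesic t : t <= k ->
  ext_dist (ext_gen (v 0)) (sched_vtx t) <= t /\
  ext_dist (sched_vtx t) (vtx (v k) (ev (mkseq l n))) <= k - t.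
Proof.
move=> tk; rewrite -sched_start -sched_end.
split; last by apply: sched_dist; rewrite tk leqnn.
by rewrite -[X in _ <= X]subn0; apply: sched_dist.
Qed.

End OneSchedule.
End Schedules.

(** * Vertices that geodesics must pass *)

Section Cuts.
Variable G : sgraph.
Hypothesis Gconn : connected_graph G.
Variables (n : nat) (l : nat -> G * bool).

Lemma geodesic_schedule a b : reduced (mkseq l n) ->
  exists v c, [/\ schedule n l (ext_dist (ext_gen a) (vtx b (ev (mkseq l n)))) v c,
    v 0 = a & v (ext_dist (ext_gen a) (vtx b (ev (mkseq l n)))) = b].
Proof.
move=> rl; rewrite /ext_dist.
have [p [hp hl <-]] := gdist_walk (ext_connected Gconn (ext_gen a) (vtx b (ev (mkseq l
  n)))).
exact: path_schedule.
Qed.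

Section OneSchedule.
Variables (k : nat) (v : nat -> G) (c : nat -> nat).
Hypothesis S : schedule n l k v c.

Lemma sched_lt_adj r s : r < s -> s < n -> c s < c r -> adj (l r).1 (l s).1.
Proof.
by move=> rs sn; apply: contraTT; rewrite -leqNgt; case: S => _ _ _; apply.
Qed.

Lemma sched_star r : r < n -> in_star (v (c r)) (l r).
Proof. by case: S => h1 h2 h3 h4 h; auto. Qed.

Lemma sched_le r : r < n -> c r <= k.
Proof. by case: S => h1 h2 h3 h4 h; auto. Qed.

Lemma sched_adj t : t < k -> adj (v t) (v t.+1).
Proof. by case: S => h1 h2 h3 h4 h; auto. Qed.

(** When [k] is the distance between the two ends, this says that the vertex lies on a geodesic. *)
Definition goes_through z p :=
  ext_dist (ext_gen (v 0)) (vtx z (ev (mkseq l p))) +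
  ext_dist (vtx z (ev (mkseq l p))) (vtx (v k) (ev (mkseq l n))) <= k.

Lemma goes_through_sched z p t : t <= k ->
  sched_vtx n l v c t = vtx z (ev (mkseq l p)) -> goes_through z p.
Proof.
move=> tk e; have [h1 h2] := sched_geodesic Gconn S tk.
by rewrite /goes_through -e; lia.
Qed.

(* Seen from [z], only such a letter can distinguish the letters spent before time
   [t] from the prefix of length [p]. *)
Definition bad p z t r :=
  [&& r < n, (c r < t) != (r < p) & ~~ in_star z (l r)].

Lemma no_bad p z t : p <= n -> (forall r, ~~ bad p z t r) ->
  vtx z (ev (subword l n (fun r => c r < t))) = vtx z (ev (mkseq l p)).
Proof.
move=> pn h; rewrite -(subword_prefix l pn); apply: vtx_ideal.
- exact: sched_ideal S _.
- exact: ideal_prefix.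
- by move=> r rn ne; have := h r; rewrite /bad rn ne negbK.
Qed.

Lemma bad_dec p z t : (forall r, ~~ bad p z t r) \/ exists r, bad p z t r.
Proof.
case: (boolP [forall r : 'I_n, ~~ bad p z t r]) => [/forallP h|/forallPn[r nr]];
  [left|right].
  by move=> r; case: (ltnP r n) => rn; [apply: (h (Ordinal rn))|rewrite /bad ltnNge rn].
by exists r; rewrite -[bad _ _ _ _]negbK.
Qed.

(** [E] collects the letters before [p] when ordered by time, then by position. It differs from the
    prefix only by letters commuting with letter [p], and from the letters spent before [c p] only
    by letters in the star of [v (c p)]. Both vertices thus sit over one group element, at
    generators that are equal or adjacent. *)
Lemma sched_near p : p < n ->
  let X := vtx (l p).1 (ev (mkseq l p)) in
  ext_dist (sched_vtx n l v c (c p)) X <= 1 /\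
  (v (c p) = (l p).1 -> sched_vtx n l v c (c p) = X).
Proof.
move=> pn X; pose E r := (c r < c p) || ((c r == c p) && (r < p)).
have idE : ideal l n E.
  move=> r s rs sn nadj; have : c r <= c s by case: S => _ _ _; apply.
  by rewrite /E; move: rs; lia.
have eX : X = vtx (l p).1 (ev (subword l n E)).
  rewrite /X -(subword_prefix l (ltnW pn)); apply: vtx_ideal => //.
    exact: ideal_prefix.
  move=> r rn ne; rewrite /in_star; case: (ltngtP r p) ne => [rp|rp|->];
    last by rewrite eqxx.
    rewrite /E rp andbT => ne; rewrite adj_sym sched_lt_adj ?orbT //; lia.
  by rewrite /E => ne; rewrite sched_lt_adj ?orbT //; lia.
have eS : sched_vtx n l v c (c p) = vtx (v (c p)) (ev (subword l n E)).
  apply: vtx_ideal => //; first exact: sched_ideal S _.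
  move=> r rn; rewrite /E => ne.
  have <- : c r = c p by lia.
  exact: sched_star.
split; last by rewrite eX eS => ->.
rewrite eX eS; have := sched_star pn; rewrite /in_star => /orP[/eqP ->|h].
  by rewrite ext_dist0.
exact/ext_dist_adj/vtx_adj.
Qed.

(** * Cutting at an edge when the girth is at least six *)

Section Edge.
Hypothesis tri : forall x y z : G, adj x y -> adj y z -> adj z x -> False.
Hypothesis sq : forall x y z w : G,
  adj x y -> adj y z -> adj z w -> adj w x -> x = z \/ y = w.
Hypothesis pent : forall x y z w u : G,
  adj x y -> adj y z -> adj z w -> adj w u -> adj u x -> False.

Lemma not_in_star (x y : G) s : adj x y -> in_star x s -> ~~ in_star y s ->
  [/\ adj x s.1, s.1 <> y & ~~ adj y s.1].
Proof.
rewrite /in_star => xy /orP[/eqP ->|xs]; first by rewrite negb_or adj_sym xy andbF.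
by rewrite negb_or => /andP[/eqP ? ?].
Qed.

(* If the letters [p] and [p.+1] are spent at times at least 3 apart, the path can
   be rerouted along the edge they span, and girth at least 6 leaves no other times
   than equal or consecutive ones; there the order constraints rule out the letters
   that would keep the path off both ends of the edge. *)
Lemma cut_edge_sched p : p.+1 < n -> adj (l p).1 (l p.+1).1 ->
  goes_through (l p).1 p \/ goes_through (l p.+1).1 p.
Proof.
move=> pn; set j := (l p).1; set h := (l p.+1).1 => jh.
have hj : adj h j by rewrite adj_sym.
have pn' := ltnW pn.
have [nearX eqX] := sched_near pn'; have [nearA eqA] := sched_near pn.
rewrite -/j -/h in nearX eqX nearA eqA.
have eA : vtx h (ev (mkseq l p.+1)) = vtx h (ev (mkseq l p)).
  by rewrite mkseqS -cats1 ev_cat vtx_star //= /in_star -/j hj orbT.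
rewrite eA in nearA eqA.
have XA : ext_dist (vtx j (ev (mkseq l p))) (vtx h (ev (mkseq l p))) <= 1.
  exact/ext_dist_adj/vtx_adj.
have AX : ext_dist (vtx h (ev (mkseq l p))) (vtx j (ev (mkseq l p))) <= 1.
  exact/ext_dist_adj/vtx_adj.
have ki := sched_le pn'; have ki' := sched_le pn.
have [i ei] : exists i, c p = i by exists (c p).
have [i' ei'] : exists i', c p.+1 = i' by exists (c p.+1).
rewrite ei in nearX eqX ki; rewrite ei' in nearA eqA ki'.
have [di1 di2] := sched_geodesic Gconn S ki.
have [di1' di2'] := sched_geodesic Gconn S ki'.
have T := ext_dist_triangle Gconn.
set yi := sched_vtx _ _ _ _ i in nearX eqX di1 di2.
set yi' := sched_vtx _ _ _ _ i' in nearA eqA di1' di2'.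
have nearX' : ext_dist (vtx j (ev (mkseq l p))) yi <= 1 by rewrite ext_dist_sym.
have nearA' : ext_dist (vtx h (ev (mkseq l p))) yi' <= 1 by rewrite ext_dist_sym.
(* The detour [yi], vertex over [j], vertex over [h], [yi'] takes at most three steps. *)
case: (leqP (i + 3) i') => ii3.
  left; rewrite /goes_through.
  have := T yi (ext_gen (v 0)) (vtx j (ev (mkseq l p))).
  have := T (vtx h (ev (mkseq l p))) (vtx j (ev (mkseq l p))) (vtx (v k) (ev (mkseq l
    n))).
  have := T yi' (vtx h (ev (mkseq l p))) (vtx (v k) (ev (mkseq l n))).
  lia.
case: (leqP (i' + 3) i) => ii3'.
  left; rewrite /goes_through.
  have := T yi' (ext_gen (v 0)) (vtx h (ev (mkseq l p))).
  have := T (vtx h (ev (mkseq l p))) (ext_gen (v 0)) (vtx j (ev (mkseq l p))).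
  have := T yi (vtx j (ev (mkseq l p))) (vtx (v k) (ev (mkseq l n))).
  lia.
have := sched_star pn'; rewrite {1}/in_star -/j ei => /orP[/eqP e|aij].
  by left; apply: goes_through_sched ki (eqX (esym e)).
have := sched_star pn; rewrite {1}/in_star -/h ei' => /orP[/eqP e|aih].
  by right; apply: goes_through_sched ki' (eqA (esym e)).
have throughX t : t <= k -> v t = j -> (forall r, ~~ bad p j t r) -> goes_through j p.
  by move=> tk vt /(no_bad (ltnW pn')) e; apply: (goes_through_sched tk);
    rewrite /sched_vtx vt.
have throughXS t : t <= k -> v t = j -> (forall r, ~~ bad p j t.+1 r) -> goes_through j p.
  by move=> tk vt /(no_bad (ltnW pn')) e; apply: (goes_through_sched tk);
    rewrite (sched_vtxS S tk) vt.
have throughA t : t <= k -> v t = h -> (forall r, ~~ bad p h t r) -> goes_through h p.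
  by move=> tk vt /(no_bad (ltnW pn')) e; apply: (goes_through_sched tk);
    rewrite /sched_vtx vt.
have throughAS t : t <= k -> v t = h -> (forall r, ~~ bad p h t.+1 r) -> goes_through h p.
  by move=> tk vt /(no_bad (ltnW pn')) e; apply: (goes_through_sched tk);
    rewrite (sched_vtxS S tk) vt.
clear T nearX nearA XA AX di1 di2 di1' di2' nearX' nearA' eqX eqA eA yi yi'.
(* Now [v i] is adjacent to [j] and [v i'] to [h]. Gap 0 closes a triangle and gap 2 a pentagon; gap
   1 closes a square, which degenerates to [v i = h] or [v i' = j]. *)
have [e|[e|[e|[e|e]]]] : i = i' \/ (i' = i.+2 \/ (i = i'.+2 \/ (i' = i.+1 \/ i =
  i'.+1))) by lia.
- rewrite -e adj_sym in aih.
  by case: (tri aij jh aih).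
- have h1 : adj (v i) (v i.+1) by apply: sched_adj; lia.
  have h2 : adj (v i.+1) (v i') by rewrite e; apply: sched_adj; lia.
  by case: (pent h1 h2 aih hj); rewrite adj_sym.
- have h1 : adj (v i') (v i'.+1) by apply: sched_adj; lia.
  have h2 : adj (v i'.+1) (v i) by rewrite e; apply: sched_adj; lia.
  by case: (pent h1 h2 aij jh); rewrite adj_sym.
- have h1 : adj (v i) (v i') by rewrite e; apply: sched_adj; lia.
  have badA r : v i = h -> bad p h i' r ->
     [/\ r < p, c r = i', adj (v i') (l r).1, (l r).1 <> h & adj (l r).1 j].
    move=> vih /and3P[rn ne nh].
    have [rp cr] : r < p /\ c r = i'.
      case: (ltngtP r p) ne => [rp|rp|e']; last first.
      + by move: nh; rewrite e' /in_star -/j hj orbT.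
      + case: (ltngtP r p.+1) => [| rp1|e']; first by lia.
          move=> ne; have : adj h (l r).1 by apply: sched_lt_adj => //; lia.
          by move=> hr; move: nh; rewrite /in_star hr orbT.
        by move: nh; rewrite e' /in_star eqxx.
      + move=> ne; split => //; have [//|lt] : c r = i' \/ i' < c r by lia.
        have : adj (l r).1 h by apply: sched_lt_adj => //; lia.
        by move=> hr; move: nh; rewrite /in_star adj_sym hr orbT.
    have := sched_star rn; rewrite cr => st.
    have [s1 s2 s3] := not_in_star aih st nh.
    by split => //; apply: sched_lt_adj => //; lia.
  have badX r : bad p j i' r ->
     [/\ p < r, r < n, c r = i, adj (v i) (l r).1 & (l r).1 <> j].
    move=> /and3P[rn ne nj].
    have [rp cr] : p < r /\ c r = i.
      case: (ltngtP r p) ne => [rp|rp|e']; last first.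
      + by move: nj; rewrite e' /in_star eqxx.
      + move=> ne; split => //; have [//|lt] : c r = i \/ c r < i by lia.
        have : adj j (l r).1 by apply: sched_lt_adj => //; lia.
        by move=> hr; move: nj; rewrite /in_star hr orbT.
      + move=> ne; have : adj (l r).1 j by apply: sched_lt_adj => //; lia.
        by move=> hr; move: nj; rewrite /in_star adj_sym hr orbT.
    have := sched_star rn; rewrite cr => st.
    by have [s1 s2 s3] := not_in_star aij st nj.
  have [vih|vij] : v i = h \/ v i' = j by have := sq h1 aih hj;
    rewrite adj_sym => /(_ aij).
    have [nb|[r br]] := bad_dec p h i'.
      by right; apply: (throughAS i) => //; rewrite -e.
    have [rp cr s1 s2 s3] := badA r vih br.
    have vij : v i' = j.
      have rv : adj (l r).1 (v i') by rewrite adj_sym.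
      have jr : adj j (l r).1 by rewrite adj_sym.
      by have [] := sq rv aih hj jr.
    have [nb|[r' br']] := bad_dec p j i'.
      by left; apply: (throughX i').
    have [rp' rn' cr' s1' s2'] := badX r' br'.
    (* The letters [r < p < r'] are spent in reverse order, hence commute, and close a square with
       [j] and [h] that cannot degenerate. *)
    have rr : adj (l r).1 (l r').1.
  by apply: sched_lt_adj (ltn_trans rp rp') rn' _; rewrite cr cr' e.
    have r'r : adj (l r').1 (l r).1 by rewrite adj_sym.
    rewrite vih in s1'.
    by have [//|e'] := sq s3 jh s1' r'r; case: s2'.
  have [nb|[r' br']] := bad_dec p j i'.
    by left; apply: (throughX i').
  have [rp' rn' cr' s1' s2'] := badX r' br'.
  have hr : adj h (l r').1.
    apply: sched_lt_adj => //; last lia.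
    by rewrite ltn_neqAle rp' andbT; apply/eqP => e'; move: cr'; rewrite -e'; lia.
  have vih : v i = h.
    have rv : adj (l r').1 (v i) by rewrite adj_sym.
    by have [] := sq rv aij jh hr.
  have [nb|[r br]] := bad_dec p h i'.
    by right; apply: (throughAS i) => //; rewrite -e.
  have [rp cr s1 s2 s3] := badA r vih br.
  have rr : adj (l r).1 (l r').1.
  by apply: sched_lt_adj (ltn_trans rp rp') rn' _; rewrite cr cr' e.
  have r'r : adj (l r').1 (l r).1 by rewrite adj_sym.
  by have [//|e'] := sq s3 jh hr r'r; case: s2'.
- have h1 : adj (v i') (v i) by rewrite e; apply: sched_adj; lia.
  have badX r : bad p j i r ->
     [/\ r < p, c r = i, adj (v i) (l r).1, (l r).1 <> j & adj (l r).1 h].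
    move=> /and3P[rn ne nj].
    have [rp cr] : r < p /\ c r = i.
      case: (ltngtP r p) ne => [rp|rp|e']; last first.
      + by move: nj; rewrite e' /in_star eqxx.
      + move=> ne; have : adj j (l r).1 by apply: sched_lt_adj => //; lia.
        by move=> hr; move: nj; rewrite /in_star hr orbT.
      + move=> ne; split => //; have [//|lt] : c r = i \/ i < c r by lia.
        have : adj (l r).1 j by apply: sched_lt_adj => //; lia.
        by move=> hr; move: nj; rewrite /in_star adj_sym hr orbT.
    have := sched_star rn; rewrite cr => st.
    have [s1 s2 s3] := not_in_star aij st nj.
    by split => //; apply: sched_lt_adj => //; lia.
  have badA r : bad p h i r ->
     [/\ p < r, r < n, c r = i', adj (v i') (l r).1 & (l r).1 <> h /\ adj j (l r).1].
    move=> /and3P[rn ne nh].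
    have [rp cr] : p < r /\ c r = i'.
      case: (ltngtP r p) ne => [rp|rp|e']; last first.
      + by move: nh; rewrite e' /in_star -/j hj orbT.
      + move=> ne; split => //; case: (ltngtP r p.+1) => [| rp1|e']; first by lia.
          have [//|lt] : c r = i' \/ c r < i' by lia.
          have : adj h (l r).1 by apply: sched_lt_adj => //; lia.
          by move=> hr; move: nh; rewrite /in_star hr orbT.
        by move: nh; rewrite e' /in_star eqxx.
      + move=> ne; have : adj (l r).1 h by apply: sched_lt_adj => //; lia.
        by move=> hr; move: nh; rewrite /in_star adj_sym hr orbT.
    have := sched_star rn; rewrite cr => st.
    have [s1 s2 s3] := not_in_star aih st nh.
    by split => //; split => //; apply: sched_lt_adj => //; lia.
  have both r r' : bad p j i r -> bad p h i r' -> v i = h -> v i' = j -> False.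
    move=> /badX[rp cr s1 s2 s3] /badA[rp' rn' cr' s1' [s2' s3']] vih vij.
    have rr : adj (l r).1 (l r').1.
  by apply: sched_lt_adj (ltn_trans rp rp') rn' _; rewrite cr cr' e.
    have r'r : adj (l r').1 (l r).1 by rewrite adj_sym.
    by have [//|e'] := sq s3 hj s3' r'r; case: s2'.
  have [vij|vih] : v i' = j \/ v i = h by have := sq h1 aij jh;
    rewrite adj_sym => /(_ aih).
    have [nb|[r br]] := bad_dec p j i.
      by left; apply: (throughXS i') => //; rewrite -e.
    have [rp cr s1 s2 s3] := badX r br.
    have vih : v i = h.
      have rv : adj (l r).1 (v i) by rewrite adj_sym.
      have hr : adj h (l r).1 by rewrite adj_sym.
      by have [] := sq rv aij jh hr.
    have [nb|[r' br']] := bad_dec p h i.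
      by right; apply: (throughA i).
    by case: (both r r').
  have [nb|[r' br']] := bad_dec p h i.
    by right; apply: (throughA i).
  have [rp' rn' cr' s1' [s2' s3']] := badA r' br'.
  have vij : v i' = j.
    have rv : adj (l r').1 (v i') by rewrite adj_sym.
    by have [] := sq rv aih hj s3'.
  have [nb|[r br]] := bad_dec p j i.
    by left; apply: (throughXS i') => //; rewrite -e.
  by case: (both r r').
Qed.

End Edge.

(** Consecutive letters do not commute, so [c] is monotone and the letters spent before any time
    form a prefix. If [v (c p)] is a neighbour of letter [p], it serves; otherwise it is that
    letter, the previous letter cannot be spent there, and the vertex of the walk one step earlier
    serves. *)
Lemma cut_chain_sched p : 0 < p < n ->
  (forall r, r.+1 < n -> ~~ adj (l r).1 (l r.+1).1) ->
  (l p.-1).1 != (l p).1 ->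
  exists2 z, adj (l p).1 z & goes_through z p.
Proof.
move=> /andP[p0 pn] chain ne.
have mono r s : r <= s -> s < n -> c r <= c s.
  elim: s => [|s IH]; first by rewrite leqn0 => /eqP ->.
  rewrite leq_eqVlt => /orP[/eqP -> //|rs sn].
  apply: leq_trans (IH rs (ltnW sn)) _.
  by case: S => _ _ _; apply => //; apply: chain.
have kp := sched_le pn; have := sched_star pn; rewrite {1}/in_star => /orP[/eqP e|h].
  have nadj : ~~ adj (l p.-1).1 (l p).1 by have := chain p.-1; rewrite prednK //; apply.
  have lt : c p.-1 < c p.
    rewrite ltn_neqAle mono ?leq_pred // andbT; apply/eqP => e'.
    have pn1 : p.-1 < n by lia.
    have := sched_star pn1; rewrite e' -e /in_star (negbTE ne) /= adj_sym.
    by rewrite (negbTE nadj).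
  have c0 : (c p).-1.+1 = c p by lia.
  exists (v (c p).-1).
    by rewrite e adj_sym -{2}c0; apply: sched_adj; lia.
  apply: (@goes_through_sched _ _ (c p).-1); first by lia.
  rewrite (sched_vtxS S) ?c0; last by lia.
  apply: no_bad; first exact: ltnW.
  move=> r; apply/and3P => -[rn + _]; case: (ltnP r p) => rp.
    by have := @mono r p.-1; lia.
  by have := @mono p r; lia.
exists (v (c p)); first by rewrite adj_sym.
apply: (@goes_through_sched _ _ (c p)) => //.
apply: no_bad; first exact: ltnW.
move=> r; apply/and3P => -[rn + /negP]; case: (ltnP r p) => rp;
  last by have := @mono p r; lia.
move=> ne'; have <- : c r = c p by have := @mono r p; lia.
by move=> /(_ (sched_star rn)).
Qed.

(* [B] is the side of [(l p).1] in the graph with the edge [(l p).1 -- b] removed.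
   The path may cross this edge several times; [tau] is late enough for all letters
   of the far side that precede [q] to be spent by the next visit [t] to [b]. *)
Lemma cut_tree_sched (B : pred G) b q p : q < p < n ->
  (forall x y, adj x y -> B x -> ~~ B y -> x = (l p).1 /\ y = b) ->
  B (l p).1 -> adj (l p).1 b -> ~~ B (l q).1 -> ~~ adj (l q).1 (l p).1 ->
  (forall r, q < r < p -> (l r).1 = b) ->
  goes_through b p.
Proof.
move=> /andP[qp pn]; set j := (l p).1; set a := (l q).1.
move=> sep Bj jb Ba naj btw.
have qn := ltn_trans qp pn.
have aB x : adj a x -> B x -> False.
  rewrite adj_sym => xa Bx; have [ex ea] := sep _ _ xa Bx Ba.
  by move: naj; rewrite adj_sym ea jb.
have sqi : c q <= c p by case: S => _ _ _; apply.
have [i ei] : exists i, c p = i by exists (c p).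
have [s es] : exists s, c q = s by exists (c q).
rewrite ei es in sqi.
have ki : i <= k by rewrite -ei; apply: sched_le.
(* These letters commute with [a], so they are on the far side but may be spent after [q]; the time
   [tau] waits for them too. *)
pose R1 r := [&& r < q, adj a (l r).1, (l r).1 != b & c r <= i].
pose T1 t := (t == s) || [exists r : 'I_n, R1 r && (c r == t)].
have exT : exists t, T1 t by exists s; rewrite /T1 eqxx.
have bT t : T1 t -> t <= i.
  by case/orP=> [/eqP ->//|/existsP[r /andP[/and4P[_ _ _ h] /eqP <-]]].
case: (ex_maxnP exT bT) => tau T1tau maxtau.
have stau : s <= tau by apply: maxtau; rewrite /T1 eqxx.
have R1tau r : r < q -> adj a (l r).1 -> (l r).1 != b -> c r <= i -> c r <= tau.
  move=> rq ar rb ri; apply: maxtau; apply/orP; right; apply/existsP.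
  by exists (Ordinal (ltn_trans rq qn)); rewrite /R1 rq ar rb ri eqxx.
have tau_spec : tau = s \/ exists2 r, [/\ r < q, adj a (l r).1 & (l r).1 != b] & c r =
  tau.
  case/orP: T1tau => [/eqP e|/existsP[r /andP[/and4P[rq ar rb _] /eqP e]]]; first by left.
  by right; exists r.
have taui := bT _ T1tau.
clear T1tau maxtau bT exT T1 R1.
(* Some letter spent at time [tau] lies on the far side and is not [b], the only far vertex with a
   neighbour in [B]. *)
have nBv : ~~ B (v tau).
  apply/negP => Bv; case: tau_spec => [e|[r [rq ar rb] e]].
    have := sched_star qn; rewrite es -e /in_star -/a => /orP[/eqP e'|va].
      by rewrite e' Bv in Ba.
    by apply: (aB (v tau)); rewrite // adj_sym.
  have := sched_star (ltn_trans rq qn); rewrite e /in_star => /orP[/eqP e'|vr].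
    by apply: (aB (l r).1) => //; rewrite e'.
  case: (boolP (B (l r).1)) => [Br|nBr]; first exact: (aB (l r).1).
  by have [_ e'] := sep _ _ vr Bv nBr; rewrite e' eqxx in rb.
have inB2 : (tau <= i) && (B (v i) || (v i == b)).
  rewrite taui /=; have := sched_star pn; rewrite ei /in_star -/j.
  case/orP=> [/eqP <-|vj]; first by rewrite Bj.
  case: (boolP (B (v i))) => //= nB.
  by rewrite adj_sym in vj; have [_ ->] := sep _ _ vj Bj nB; rewrite eqxx.
(* The walk is in [B] or at [b] at time [i], and it enters [B] only from [b]; so the first such time
   from [tau] on is a visit to [b]. *)
have exT2 : exists t, (tau <= t) && (B (v t) || (v t == b)) by exists i.
case: (ex_minnP exT2) => t /andP[taut Bt] mint.
have ti : t <= i by apply: mint.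
clear exT2 inB2.
have before t' : tau <= t' -> t' < t -> ~~ B (v t').
  by move=> h1 h2; apply/negP => Bt'; have := mint t'; rewrite h1 Bt' => /(_ isT);
    rewrite leqNgt h2.
have vt : v t = b.
  case/orP: Bt => [Bt|/eqP //]; have lt : tau < t.
    by rewrite ltn_neqAle taut andbT; apply/eqP => e; rewrite e Bt in nBv.
  have t1 : t.-1.+1 = t by rewrite prednK // (leq_ltn_trans _ lt).
  have nB : ~~ B (v t.-1) by apply: before; rewrite -ltnS t1.
  have : adj (v t) (v t.-1) by rewrite adj_sym -{2}t1; apply: sched_adj; lia.
  move=> /sep/(_ Bt nB)[_ e]; have := mint t.-1.
  by rewrite e eqxx orbT -ltnS t1 lt => /(_ isT); rewrite -{1}t1 ltnn.
clear mint Bt.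
apply: (@goes_through_sched _ _ t); first exact: leq_trans ti ki.
rewrite /sched_vtx vt; apply: no_bad; first exact: ltnW.
(* A bad letter [r < q] unspent at [t] would be spent after [i], hence be adjacent to both [a] and
   [j], which only [b] can be. A bad letter [r > p] spent before [t] would lie in [B], be spent
   before [tau], and commute with a far letter spent at [tau]; only [j] has a far neighbour, and the
   letter is adjacent to [j]. *)
move=> r; apply/and3P => -[rn ne nb]; case: (ltngtP r p) ne => [rp|rp|->].
- rewrite eqb_id -leqNgt => tc.
  have ctr : c r = t -> False.
    by move=> e; have := sched_star rn; rewrite e vt (negbTE nb).
  case: (ltngtP r q) => [rq|rq|e].
  + have rlb : (l r).1 != b by apply: contra nb => /eqP e; rewrite /in_star e eqxx.
    have cs : c r <> s by move=> e; apply: ctr; lia.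
    have ar : adj a (l r).1 by rewrite adj_sym; apply: sched_lt_adj => //; lia.
    case: (leqP (c r) i) => ci.
      by have := R1tau r rq ar rlb ci => ?; apply: ctr; lia.
    have rj : adj (l r).1 j by apply: sched_lt_adj => //; lia.
    case: (boolP (B (l r).1)) => Br; first exact: (aB (l r).1).
    by rewrite adj_sym in rj; have [_ e] := sep _ _ rj Bj Br; rewrite e eqxx in rlb.
  + by move: nb; rewrite /in_star btw ?eqxx // rq.
  + by apply: ctr; rewrite e in tc *; lia.
- rewrite eqbF_neg negbK => ct'.
  have jr : adj j (l r).1 by apply: sched_lt_adj => //; lia.
  have rlb : (l r).1 != b by apply: contra nb => /eqP e; rewrite /in_star e eqxx.
  have Br : B (l r).1.
    by apply: contraT => nB; have [_ e] := sep _ _ jr Bj nB; rewrite e eqxx in rlb.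
  have Bv : B (v (c r)).
    have := sched_star rn; rewrite /in_star => /orP[/eqP <-//|]; rewrite adj_sym => vr.
    apply: contraT => nB; have [e _] := sep _ _ vr Br nB.
    by rewrite e adj_irr in jr.
  have ltau : c r < tau.
    by rewrite ltnNge; apply/negP => h; have := before _ h ct'; rewrite Bv.
  case: tau_spec => [e|[r1 [rq ar rb] e]].
    have : adj a (l r).1.
      by apply: sched_lt_adj (ltn_trans qp rp) rn _; rewrite es -e.
    by move/aB/(_ Br).
  have rr : adj (l r).1 (l r1).1.
    rewrite adj_sym; apply: sched_lt_adj rn _; last by rewrite e.
    exact: ltn_trans rq (ltn_trans qp rp).
  case: (boolP (B (l r1).1)) => [|nB1]; first exact: aB.
  by have [e' _] := sep _ _ rr Br nB1; rewrite e' adj_irr in jr.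
- by rewrite eqbF_neg negbK ei ltnNge ti.
Qed.

End OneSchedule.
End Cuts.

(** * Periodic words and translation lengths *)

Section Periodic.
Variable G : sgraph.
Local Open Scope group_scope.

Lemma mkseqD (A : Type) (l : nat -> A) m n :
  mkseq l (m + n) = mkseq l m ++ mkseq (fun i => l (m + i)) n.
Proof.
rewrite /mkseq iotaD map_cat add0n; congr (_ ++ _).
by rewrite -[in LHS](addn0 m) iotaDl -map_comp.
Qed.

Lemma red_mkseq (l : nat -> G * bool) n :
  (forall i j, i < j -> j < n -> l j = inv_letter (l i) ->
     exists2 m, i < m < j & ~~ adj (l m).1 (l i).1) -> reduced (mkseq l n).
Proof.
move=> h; apply: contraT => /nred_split[x [t [y [z [e al]]]]].
have sz : size x + (size y + (size z).+1).+1 = n.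
  by have := congr1 size e; rewrite size_mkseq size_cat /= size_cat.
have nthE m : m < n -> l m = nth t (x ++ t :: y ++ inv_letter t :: z) m.
  by move=> mn; rewrite -e nth_mkseq.
have lx : l (size x) = t by rewrite nthE ?nth_cat ?ltnn ?subnn //; lia.
have ly : l (size x + (size y).+1) = inv_letter t.
  rewrite nthE; last by lia.
  rewrite nth_cat ifN ?addKn /=; last by lia.
  by rewrite nth_cat ltnn subnn.
have [|||m mb] := h (size x) (size x + (size y).+1); rewrite ?lx ?ly //; try lia.
rewrite nthE; last by lia.
rewrite nth_cat ifN; last by lia.
have -> : m - size x = (m - (size x).+1).+1 by lia.
rewrite /= nth_cat ifT; last by lia.
have my : m - (size x).+1 < size y by lia.
by rewrite (allP al) ?mem_nth.
Qed.

Definition min_word (l : nat -> G * bool) L : Prop :=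
  forall w c, ev w = ev (mkseq l L) ^ c -> L <= size w.

Section OneWord.
Variables (l : nat -> G * bool) (L : nat).
Hypothesis L0 : 0 < L.
Hypothesis lL : forall i, l (L + i) = l i.

Lemma ev_period n : ev (mkseq l (n * L)) = ev (mkseq l L) ^+ n.
Proof.
elim: n => [|n IH]; first by rewrite mul0n.
rewrite mulSn mkseqD ev_cat expgS -IH; congr (_ * ev _).
by apply: eq_mkseq => i; rewrite lL.
Qed.

Lemma ev_shift i :
  ev (mkseq (fun m => l (i + m)) L) = ev (mkseq l L) ^ ev (mkseq l i).
Proof.
have e : mkseq l L ++ mkseq l i = mkseq l i ++ mkseq (fun m => l (i + m)) L.
  rewrite -mkseqD addnC mkseqD; congr (_ ++ _).
  by apply: eq_mkseq => m; rewrite lL.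
rewrite conjgE; apply: (mulgI (ev (mkseq l i))).
by rewrite mulVKg -(ev_cat (mkseq l L)) e ev_cat.
Qed.

Lemma min_word_shift i : min_word l L -> min_word (fun m => l (i + m)) L.
Proof. by move=> h w c; rewrite ev_shift -conjgM; apply: h. Qed.

(** A cancelling pair less than a period apart lies in one cyclic shift, and deleting it would give
    a shorter conjugate. Exactly a period apart the letters are equal; farther apart, the pair
    encloses a copy of its first letter, which is not adjacent to itself. *)
Lemma min_word_red n : min_word l L -> reduced (mkseq l n).
Proof.
move=> hmin; apply: red_mkseq => i j ij jn e.
case: (boolP [exists m : 'I_j, (i < m) && ~~ adj (l m).1 (l i).1]).
  by case/existsP=> m /andP[im h]; exists (val m); rewrite ?im /=.
move/existsPn => al; have {}al m : i < m < j -> adj (l m).1 (l i).1.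
  by case/andP=> im mj; have := al (Ordinal mj); rewrite /= im negbK.
have jL : j < i + L.
  rewrite ltnNge leq_eqVlt; apply/negP => /orP[/eqP ej|h].
    by move: e; rewrite -ej addnC lL => /esym/eqP; rewrite inv_letter_neq.
  have := al (i + L); rewrite h addnC lL adj_irr andbT -{1}[i]add0n ltn_add2r L0.
  by move/(_ isT).
pose d := j - i.+1; pose r := i + L - j.+1.
have eL : L = 1 + (d + (1 + r)) by rewrite /d /r; lia.
pose Y := mkseq (fun m => l (i + (1 + m))) d.
pose Z := mkseq (fun m => l (i + (1 + (d + (1 + m))))) r.
have eW : mkseq (fun m => l (i + m)) L = [:: l i] ++ (Y ++ ([:: inv_letter (l i)] ++ Z)).
  rewrite eL mkseqD; congr (_ ++ _); first by rewrite /mkseq /= addn0.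
  rewrite mkseqD; congr (_ ++ _); rewrite mkseqD; congr (_ ++ _).
  rewrite /mkseq /= -e; congr [:: l _]; rewrite /d; lia.
have := hmin (Y ++ Z) (ev (mkseq l i)); rewrite -ev_shift eW.
rewrite !size_cat !size_mkseq ev_cat.
have -> : ev ([:: l i] ++ (Y ++ ([:: inv_letter (l i)] ++ Z))) = ev Y * ev Z.
  rewrite !ev_cat ev_inv_letter mulgA.
  have -> : ev [:: l i] * ev Y = ev Y * ev [:: l i].
    apply: commute_letters; rewrite all_map; apply/allP => m.
    by rewrite mem_iota add0n => /andP[_ md] /=; apply: al; move: md; rewrite /d; lia.
  by rewrite -mulgA mulVKg.
by move=> /(_ erefl); lia.
Qed.

End OneWord.

Lemma min_word_exists (a : G) (g : raag G) : exists L (l : nat -> G * bool) c,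
  ev (mkseq l L) = g ^ c /\
  (L = 0 \/ [/\ 0 < L, forall i, l (L + i) = l i & min_word l L]).
Proof.
pose P m := `[< exists w c, ev w = g ^ c /\ size w = m >].
have exP : exists m, P m.
  by have [w e] := ev_surj g; exists (size w); apply/asboolP; exists w, 1; rewrite conjg1.
case: (ex_minnP exP) => L /asboolP[w [c [e sz]]] minL.
case: w e sz => [|x w] e sz.
  by exists 0, (fun=> (a, true)), c; split; [rewrite -e|left].
exists L, (fun i => nth x (x :: w) (i %% L)), c.
have L0 : 0 < L by rewrite -sz.
have ew : mkseq (fun i => nth x (x :: w) (i %% L)) L = x :: w.
  apply: (@eq_from_nth _ x); rewrite size_mkseq // => i iL.
  by rewrite nth_mkseq // modn_small.
rewrite ew; split => //; right; split => // [i|w' c']; first by rewrite modnDl.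
rewrite ew e -conjgM => e'; apply: minL; apply/asboolP.
by exists w', (c * c').
Qed.

End Periodic.

(** * Translation lengths from two cut vertices *)

Section Translation.
Import numFieldNormedType.Exports.
Variables (R : realType) (G : sgraph).
Hypothesis Gconn : connected_graph G.
Local Open Scope classical_set_scope.
Local Open Scope group_scope.
Implicit Types (a b z : G) (g h : raag G).

Lemma tau_eq (t : R) (K : nat) (x : ext_vertex G) g :
  (forall n, (n%:R * t - K%:R <= (ext_dist x (ext_act x (g ^+ n)%g))%:R <= n%:R * t +
    K%:R)%R) ->
  tau R x g = t.
Proof.
move=> h; have cK : ((K%:R / n%:R : R) @[n --> \oo] --> (0 : R))%R.
  rewrite -[X in _ --> X](mulr0 (K%:R)%R).
  apply: cvgMl_tmp; apply/gtr0_cvgV0; last exact: cvgr_idn.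
  by exists 1%N => // n /= n0; rewrite ltr0n.
apply: cvg_unique (tau_cvg R Gconn x g) _ => //.
apply: (@squeeze_cvgr _ _ _ _ (fun n => t - K%:R / n%:R)%R (fun n => t + K%:R / n%:R)%R).
- exists 1%N => // n /= n0; have n0R : (0 < n%:R :> R)%R by rewrite ltr0n.
  have /andP[h1 h2] := h n.
  rewrite ler_pdivlMr // ler_pdivrMr // mulrBl mulrDl divfK ?gt_eqF //.
  by rewrite [(t * _)%R]mulrC h1.
- by rewrite -[X in _ --> X]subr0; apply: cvgB => //; apply: cvg_cst.
- by rewrite -[X in _ --> X]addr0; apply: cvgD => //; apply: cvg_cst.
Qed.

Lemma tau_conj (x : ext_vertex G) g c : tau R x (g ^ c) = tau R x g.
Proof.
rewrite (tau_indep R Gconn x (ext_act x c^-1) g) /tau.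
congr (limn _); apply/funext => n; congr (_%:R / _)%R.
rewrite -[LHS](ext_dist_act Gconn c^-1) -!ext_actM; congr (ext_dist _ (ext_act _ _)).
by rewrite -conjXg conjgE -!mulgA mulgV mulg1.
Qed.

Definition vdist a b h := ext_dist (ext_gen a) (vtx b h).

Lemma vdist_act a b h k : ext_dist (vtx a h) (vtx b (h * k)) = vdist a b k.
Proof. by rewrite -[vtx a h]/(ext_act (ext_gen a) h^-1) -vtx_act ext_dist_act. Qed.

Lemma ext_act_expV a h n : ext_act (ext_gen a) (h^-1 ^+ n) = vtx a (h ^+ n).
Proof. by rewrite expVgn. Qed.

Lemma vdist_triangle c a b h k : vdist a b (h * k) <= vdist a c h + vdist c b k.
Proof. by rewrite -(vdist_act c b h k); apply: ext_dist_triangle. Qed.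

Lemma tau_star a h w : h = ev w -> all (in_star a) w -> tau R (ext_gen a) h^-1 = 0%R.
Proof.
move=> -> aw; apply: (@tau_eq _ 0) => n; rewrite ext_act_expV.
have -> : vtx a (ev w ^+ n) = ext_gen a.
  elim: n => [|n IH]; first by rewrite expg0 vtx1.
  by rewrite expgSr vtx_star.
by rewrite ext_dist0 mulr0 addr0 subr0 lexx.
Qed.

Local Close Scope group_scope.

Lemma tau_two_states h z1 z2 (x : ext_vertex G) :
  (forall a b n, exists z, (z = z1 \/ z = z2) /\
     vdist a z h + vdist z b (h ^+ n.+1)%g <= vdist a b (h ^+ n.+2)%g) ->
  exists s : nat, tau R x h^-1%g = (s%:R / 2)%R /\
    [\/ s = 2 * vdist z1 z1 h, s = 2 * vdist z2 z2 h |
        s = vdist z1 z2 h + vdist z2 z1 h].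
Proof.
move=> cut; set A11 := vdist z1 z1 h; set A22 := vdist z2 z2 h.
set A12 := vdist z1 z2 h; set A21 := vdist z2 z1 h.
pose s := minn (2 * A11) (minn (2 * A22) (A12 + A21)).
(* [phi] is a potential for the 2 x 2 min-plus matrix [A], whose least cycle mean
   is [s / 2]. *)
pose phi (i : bool) := if i then 2 * A12 else s.
pose zz (i : bool) := if i then z1 else z2.
have zzP z : z = z1 \/ z = z2 -> exists i, z = zz i.
  by case=> ->; [exists true|exists false].
have A_ge i j : s + phi i <= 2 * vdist (zz i) (zz j) h + phi j.
  case: i; case: j; rewrite /phi /= -?/A11 -?/A12 -?/A21 -?/A22 /s; lia.
have low n i j : n.+1 * s + phi i <= 2 * vdist (zz i) (zz j) (h ^+ n.+1)%g + phi j.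
  elim: n i j => [|n IH] i j; first by rewrite mul1n expg1.
  have [z [/zzP[m ->] le]] := cut (zz i) (zz j) n.
  have := IH m j; have := A_ge i m; rewrite [n.+2 * s]mulSn; lia.
have low_diag i n : n * s <= 2 * vdist (zz i) (zz i) (h ^+ n)%g.
  by case: n => // n; have := low n i i; lia.
have up i n : vdist (zz i) (zz i) (h ^+ n)%g <= n * vdist (zz i) (zz i) h.
  elim: n => [|n IH]; first by rewrite /vdist expg0 vtx1 ext_dist0.
  rewrite expgS mulSn; apply: leq_trans (vdist_triangle (zz i) _ _ _ _) _.
  by rewrite leq_add2l.
(* Pairs of periods run from [z1] to [z2] and back; an odd power has one more period, from [z1] to
   itself, whence the constant. *)
have up2 n : 2 * vdist z1 z1 (h ^+ n)%g <= n * (A12 + A21) + 2 * A11.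
  elim/ltn_ind: n => -[|[|n]] IH.
  - by rewrite /vdist expg0 vtx1 ext_dist0.
  - by rewrite expg1 -/A11; lia.
  - rewrite !expgS mulgA.
    have := vdist_triangle z1 z1 z1 (h * h)%g (h ^+ n)%g.
    have := vdist_triangle z2 z1 z1 h h; rewrite -/A12 -/A21.
    move: (IH n (leqnSn n.+1)); rewrite !mulSn !mul0n !addn0.
    move: (A12 + A21) (n * (A12 + A21)) (A11 + A11) (vdist _ _ (h * h)%g) (vdist _ _ (h
      * h * h ^+ n)%g) (vdist _ _ (h ^+ n)%g).
    by move=> {IH cut A_ge low low_diag up zzP} *; lia.
have main i K : (forall n, 2 * vdist (zz i) (zz i) (h ^+ n)%g <= n * s + 2 * K) ->
    tau R x h^-1%g = (s%:R / 2)%R.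
  move=> hu; rewrite (tau_indep R Gconn x (ext_gen (zz i))).
  apply: (@tau_eq _ K) => n; rewrite ext_act_expV -/(vdist _ _ _).
  have h1 : (n%:R * s%:R <= 2 * (vdist (zz i) (zz i) (h ^+ n)%g)%:R :> R)%R.
    by rewrite -!natrM ler_nat.
  have h2 : (2 * (vdist (zz i) (zz i) (h ^+ n)%g)%:R <= n%:R * s%:R + 2 * K%:R :> R)%R.
    by rewrite -!natrM -natrD ler_nat.
  have K0 : (0 <= K%:R :> R)%R by [].
  apply/andP; split; lra.
exists s; have [e|[e|e]] : s = 2 * A11 \/ (s = 2 * A22 \/ s = A12 + A21) by rewrite /s;
  lia.
- split; last exact: Or31.
  apply: (main true 0) => n; have := up true n; rewrite /= -/A11 e; nia.
- split; last exact: Or32.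
  apply: (main false 0) => n; have := up false n; rewrite /= -/A22 e; nia.
- split; last exact: Or33.
  by apply: (main true A11) => n; rewrite e; apply: up2.
Qed.

(** Sending a vertex over [a] to [a] is a graph morphism to [G], so geodesics project to walks;
    parities of distances are read off there. *)
Lemma ext_dist_walk a b P Q : exists vs,
  [/\ size vs = ext_dist (vtx a P) (vtx b Q), path adj a vs & last a vs = b].
Proof.
rewrite /ext_dist.
have [p [hp hl <-]] := gdist_walk (ext_connected Gconn (vtx a P) (vtx b Q)).
by have [vs [tw [sz pt lst _ _]]] := path_factor hp hl; exists vs.
Qed.

Lemma walk_dist a vs P : path adj a vs ->
  ext_dist (vtx a P) (vtx (last a vs) P) <= size vs.
Proof.
elim: vs a => [|b vs IH] a /=; first by rewrite ext_dist0.
case/andP=> ab /IH h; apply: leq_trans (ext_dist_triangle Gconn (vtx b P) _ _) _.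
by rewrite -add1n leq_add // ext_dist_adj // vtx_adj.
Qed.

End Translation.

Section Assembly.
Variables (R : realType) (G : sgraph).
Hypothesis Gconn : connected_graph G.

(** A cut after the first period suffices: translation by [h] turns the rest into a distance for the
    next lower power. *)
Lemma tau_of_cut (l : nat -> G * bool) L z1 z2 (x : ext_vertex G) :
  0 < L -> (forall i, l (L + i) = l i) -> min_word l L ->
  (forall N k v c, schedule (N.+2 * L) l k v c ->
     exists2 z, z = z1 \/ z = z2 & goes_through (N.+2 * L) l k v z L) ->
  let h := ev (mkseq l L) in
  exists s : nat, tau R x h^-1%g = (s%:R / 2)%R /\
    [\/ s = 2 * vdist z1 z1 h, s = 2 * vdist z2 z2 h |
        s = vdist z1 z2 h + vdist z2 z1 h].
Proof.
move=> L0 lL hmin hcut h; apply: tau_two_states => // a b n.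
have rl := @min_word_red _ l L L0 lL (n.+2 * L) hmin.
have [v [c [S v0 vk]]] := geodesic_schedule Gconn a b rl.
have [z zz] := hcut _ _ _ _ S; rewrite /goes_through v0 vk (ev_period lL) -/h => ht.
exists z; split => //; move: ht.
by rewrite {1}expgS (vdist_act Gconn) /vdist.
Qed.

Lemma tau_star_word (l : nat -> G * bool) L a (x : ext_vertex G) :
  (forall i, i < L -> in_star a (l i)) -> tau R x (ev (mkseq l L))^-1%g = 0%R.
Proof.
move=> h; rewrite (tau_indep R Gconn x (ext_gen a)).
apply: (@tau_star R G Gconn a _ (mkseq l L) (erefl _)); rewrite all_map; apply/allP => i.
by rewrite mem_iota add0n => /andP[_ /h].
Qed.

Lemma tau_min_word (x : ext_vertex G) (g : raag G) :
  tau R x g = 0%R \/ exists L l, [/\ 0 < L, forall i, l (L + i) = l i, min_word l L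
    & tau R x g = tau R x (ev (mkseq l L))^-1%g :> R].
Proof.
have /card_gt0P[a _] := Gconn.1.
have [L [l [c [e [L0|[L0 lL hmin]]]]]] := min_word_exists a (g^-1)%g.
  left; rewrite -(tau_conj R Gconn x g c) -[(g ^ c)%g]invgK -conjVg -e L0.
  exact: (@tau_star_word l 0 a).
by right; exists L, l; split => //; rewrite -(tau_conj R Gconn x g c) e conjVg invgK.
Qed.

Lemma tau_shift (l : nat -> G * bool) L i (x : ext_vertex G) :
  (forall i, l (L + i) = l i) ->
  tau R x (ev (mkseq (fun m => l (i + m)) L))^-1%g = tau R x (ev (mkseq l L))^-1%g :> R.
Proof. by move=> lL; rewrite ev_shift // -conjVg tau_conj. Qed.

End Assembly.

(** * Trees *)

Section Trees.
Variable G : sgraph.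
Hypothesis Gtree : tree_graph G.

Definition cut_rel (j b : G) : rel G :=
  [rel x y | adj x y && ~~ [|| (x == j) && (y == b) | (x == b) && (y == j)]].

Lemma cut_rel_sym j b : symmetric (cut_rel j b).
Proof.
move=> x y; rewrite /cut_rel /= adj_sym; congr (_ && ~~ _).
by rewrite orbC ![_ && (x == _)]andbC.
Qed.

Lemma cut_sep j b x y : adj x y -> connect (cut_rel j b) j x ->
  ~~ connect (cut_rel j b) j y -> x = j /\ y = b.
Proof.
move=> xy Bx nBy; case: (boolP (cut_rel j b x y)) => [h|].
  by case/negP: nBy; apply: connect_trans Bx (connect1 h).
rewrite /cut_rel /= xy /= negbK => /orP[/andP[/eqP -> /eqP ->]|/andP[_ /eqP e]] //.
by rewrite e connect0 in nBy.
Qed.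

(** A simple path avoiding the edge would close up with it to a cycle. *)
Lemma cut_other j b : adj j b -> ~~ connect (cut_rel j b) j b.
Proof.
move=> jb; apply/negP => /connectP[p0 hp0 ep]; case/shortenP: hp0 ep => p hp up _ ep.
have hadj : path adj j p by apply: sub_path hp => x y /andP[].
have := Gtree.2 (j :: p); rewrite /ucycle /= rcons_path hadj -ep adj_sym jb.
have [h1 h2] : j \notin p /\ uniq p by apply/andP.
rewrite h1 h2 => /(_ isT); case: p hp {up hadj h1 h2} ep => [|x [|y p]] //= hp ep.
  by rewrite ep adj_irr in jb.
by move: hp; rewrite /cut_rel /= ep !eqxx andbF.
Qed.

Lemma exit_path (B : pred G) x p : B x -> ~~ B (last x p) ->
  exists p1 y p2, [/\ p = p1 ++ y :: p2, B (last x p1) & ~~ B y].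
Proof.
elim: p x => [|y p IH] x /= Bx; first by rewrite Bx.
case: (boolP (B y)) => By nB; last by exists [::], y, p.
by have [p1 [z [p2 [-> h1 h2]]]] := IH y By nB; exists (y :: p1), z, p2.
Qed.

(** The first edge of the walk separates the tree, so the walk comes back along it; apart from these
    two steps, two shorter closed walks remain. *)
Lemma tree_closed_walk_even (a : G) p : path adj a p -> last a p = a -> ~~ odd (size p).
Proof.
elim: (size p).+1 {-2}p a (ltnSn (size p)) => // {p} k IH [|b p] a //=.
rewrite ltnS => pk /andP[ab hp] lp; have ba : adj b a by rewrite adj_sym.
have := @exit_path (connect (cut_rel b a) b) b p (connect0 _ _).
rewrite lp cut_other // => /(_ isT)[p1 [y [p2 [ep B1 nBy]]]].
move: hp; rewrite ep cat_path /= => /and3P[hp1 h1 hp2].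
have [e1 e2] := cut_sep h1 B1 nBy.
move: lp; rewrite ep last_cat /= e2 => lp2.
have sz : size p = size p1 + (size p2).+1 by rewrite ep size_cat.
rewrite e2 in hp2.
have o1 : ~~ odd (size p1) by apply: IH hp1 e1; lia.
have o2 : ~~ odd (size p2) by apply: IH hp2 lp2; lia.
by rewrite size_cat oddD /= (negbTE o1) (negbTE o2).
Qed.

Lemma avoid_connect (j b c : G) p : path adj c p -> j \notin c :: p ->
  connect (cut_rel j b) c (last c p).
Proof.
elim: p c => [|y p IH] c /=; first by rewrite connect0.
case/andP=> cy hp; rewrite inE negb_or => /andP[jc nj].
apply: connect_trans (IH y hp nj); apply: connect1.
move: nj; rewrite inE negb_or => /andP[jy _].
by rewrite /cut_rel /= cy (eq_sym c j) (negbTE jc) (eq_sym y j) (negbTE jy) andbF.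
Qed.

Lemma tree_towards (j a : G) : a != j -> exists2 b, adj j b &
  ~~ connect (cut_rel j b) j a.
Proof.
move=> aj; have /connectP[p0 hp0 ea] := Gtree.1.2 j a; rewrite {}ea in aj *.
case/shortenP: hp0 aj => -[|b p] /= hp up _; first by rewrite eqxx.
case/andP: hp => jb hp _; exists b => //; apply/negP => B.
have /negP := cut_other jb; apply; apply: connect_trans B _.
rewrite (sym_connect_sym (@cut_rel_sym j b)); apply: avoid_connect => //.
by case/andP: up.
Qed.

Lemma tau_tree (R : realType) (x : ext_vertex G) g : exists k :
  nat, tau R x g = (2 * k)%:R%R :> R.
Proof.
have Gconn := Gtree.1.
have [->|[L [l [L0 lL hmin ->]]]] := tau_min_word R Gconn x g; first by exists 0.
(* In a closest pair of distinct non-commuting letters, every letter strictly between is adjacent to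
   both ends by minimality, hence equals the neighbour [b] of one end towards the other. Without
   such a pair all letters lie in one star. *)
pose P d := `[< exists q, (l q).1 != (l (q + d)).1 /\ ~~ adj (l q).1 (l (q + d)).1 >].
have [exP|nP] := pselect (exists d, P d); last first.
  exists 0; apply: (@tau_star_word R G Gconn l L (l 0).1) => i _.
  apply: contraT; rewrite /in_star negb_or => /andP[h1 h2].
  by case: nP; exists i; apply/asboolP; exists 0; rewrite add0n eq_sym.
case: (ex_minnP exP) => d /asboolP[q [ne nadj]] mind.
have d0 : 0 < d by rewrite lt0n; apply/eqP => e; rewrite e addn0 eqxx in ne.
have dL : d < L.
  rewrite ltnNge leq_eqVlt; apply/negP => /orP[/eqP e|lt].
    by move: ne; rewrite -e addnC lL eqxx.
  have : d <= d - L.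
    apply: mind; apply/asboolP; exists q.
    by rewrite -(lL (q + (d - L))) addnCA subnKC // ltnW.
  lia.
(* The shift moves [p] to position [L], where [tau_of_cut] needs the cut, and [q] to [L - d]. *)
set p := q + d; pose l' m := l (p + m).
have lL' i : l' (L + i) = l' i by rewrite /l' addnCA lL.
have hmin' : min_word l' L by apply: min_word_shift.
rewrite -(tau_shift R Gconn p x lL) -/l'.
have el'L : l' L = l p by rewrite /l' addnC lL.
have el'q : l' (L - d) = l q by rewrite /l' /p -addnA subnKC ?(ltnW dL) // addnC lL.
have [b jb nBa] := tree_towards ne.
pose B := connect (cut_rel (l p).1 b) (l p).1.
have cut N k v c : schedule (N.+2 * L) l' k v c ->
     exists2 z, z = b \/ z = b & goes_through (N.+2 * L) l' k v z L.
  move=> S; exists b; first by left.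
  apply: (cut_tree_sched Gconn S (B := B) (q := L - d)).
  - by apply/andP; split; [lia|nia].
  - by move=> y z; rewrite el'L; apply: cut_sep.
  - by rewrite el'L; apply: connect0.
  - by rewrite el'L.
  - by rewrite el'q.
  - by rewrite el'q el'L.
  move=> r /andP[r1 r2].
  have er : l' r = l (p + r - L) by rewrite /l' -(lL (p + r - L)) subnKC // /p; lia.
  set r' := p + r - L in er; rewrite er.
  have rq : q < r' by rewrite /r' /p; lia.
  have rp : r' < p by rewrite /r'; lia.
  have close i j : i <= j -> j - i < d -> (l i).1 = (l j).1 \/ adj (l i).1 (l j).1.
    move=> ij ijd; case: (boolP ((l i).1 == (l j).1)) => [/eqP|n1]; first by left.
    right; apply: contraT => n2.
    have : d <= j - i by apply: mind; apply/asboolP; exists i; rewrite subnKC.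
    lia.
  have [e1|a1] : (l q).1 = (l r').1 \/ adj (l q).1 (l r').1 by apply: close; lia.
    have [e2|a2] : (l r').1 = (l p).1 \/ adj (l r').1 (l p).1 by apply: close; lia.
      by move: ne; rewrite e1 e2 eqxx.
    by move: nadj; rewrite e1 a2.
  have [e2|a2] : (l r').1 = (l p).1 \/ adj (l r').1 (l p).1 by apply: close; lia.
    by move: nadj; rewrite -[q + d]/p -e2 a1.
  apply/eqP; apply: contraT => nb.
  have Br : B (l r').1.
    apply: contraT => nBr; rewrite adj_sym in a2.
    by have [_ e] := cut_sep a2 (connect0 _ _) nBr; rewrite e eqxx in nb.
  rewrite adj_sym in a1; have [e _] := cut_sep a1 Br nBa.
  by rewrite e adj_irr in a2.
have [s [-> hs]] := tau_of_cut R Gconn x L0 lL' hmin' cut.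
have [vs [sz pt lst]] := ext_dist_walk Gconn b b 1%g (ev (mkseq l' L)).
have ev2 : ~~ odd (vdist b b (ev (mkseq l' L))).
  by rewrite /vdist -vtx1 -sz; apply: tree_closed_walk_even lst.
exists (vdist b b (ev (mkseq l' L)))./2.
have -> : s = 2 * (2 * (vdist b b (ev (mkseq l' L)))./2).
  have := even_halfK ev2; rewrite -muln2.
  by case: hs => ->; lia.
by rewrite natrM mulrAC divff ?mul1r ?pnatr_eq0.
Qed.

End Trees.

(** * Cycles *)

Lemma cycle_coord n (G : sgraph) : cycle_graph n G -> exists kappa : G -> nat,
  [/\ forall x, kappa x < n, injective kappa, forall i, i < n -> exists x, kappa x = i &
      forall x y, adj x y <->
        ((kappa x).+1 = kappa y \/ (kappa y).+1 = kappa x \/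
        (kappa x = 0 /\ (kappa y).+1 = n) \/ (kappa y = 0 /\ (kappa x).+1 = n))].
Proof.
move=> [n2 [f [g fK gK] h]]; exists (fun x => val (g x)); split.
- by move=> x; apply: ltn_ord.
- by move=> x y /val_inj e; rewrite -(gK x) -(gK y) e.
- by move=> i iN; exists (f (Ordinal iN)); rewrite fK.
have S (i j : 'I_n) : (j == ordS i) <-> i.+1 = j \/ (val j = 0 /\ i.+1 = n).
  split=> [/eqP -> /=|].
    have := ltn_ord i; rewrite leq_eqVlt => /orP[/eqP e|lt].
      by right; rewrite e modnn.
    by left; rewrite modn_small.
  move=> e; apply/eqP/val_inj => /=; case: e => [e|[-> ->]]; last by rewrite modnn.
  by rewrite e modn_small.
move=> x y; rewrite -{1}(gK x) -{1}(gK y) h; split=> [/orP[]/S /=|e].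
- by lia.
- by lia.
- apply/orP; case: e => [e|[e|[e|e]]]; [left|right|right|left]; apply/S.
  + by left.
  + by left.
  + by right.
  + by right.
Qed.

Section Cycles.
Variables (n : nat) (G : sgraph) (kappa : G -> nat).
Hypothesis n5 : 5 < n.
Hypothesis kappa_lt : forall x, kappa x < n.
Hypothesis kappa_inj : injective kappa.
Hypothesis kappa_surj : forall i, i < n -> exists x, kappa x = i.
Hypothesis adjP : forall x y : G, adj x y <->
        ((kappa x).+1 = kappa y \/ (kappa y).+1 = kappa x \/
        (kappa x = 0 /\ (kappa y).+1 = n) \/ (kappa y = 0 /\ (kappa x).+1 = n)).

Lemma cycle_connected : connected_graph G.
Proof.
have [|x0 e0] := @kappa_surj 0; first by lia.
split; first by apply/card_gt0P; exists x0.
have C : forall y, connect adj x0 y.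
  move=> y; elim: (kappa y) {-2}y (erefl (kappa y)) => {y} [|m IH] y ey.
    by rewrite (@kappa_inj y x0) ?connect0 // ey e0.
  have [|z ez] := @kappa_surj m; first by have := kappa_lt y; lia.
  apply: connect_trans (IH z ez) (connect1 _); apply/adjP; lia.
move=> u v; apply: connect_trans (C v).
by rewrite (sym_connect_sym (@adj_sym G)).
Qed.

Lemma cycle_tri (x y z : G) : adj x y -> adj y z -> adj z x -> False.
Proof. by move=> /adjP h1 /adjP h2 /adjP h3; lia. Qed.

Lemma cycle_sq (x y z w : G) :
  adj x y -> adj y z -> adj z w -> adj w x -> x = z \/ y = w.
Proof.
move=> /adjP h1 /adjP h2 /adjP h3 /adjP h4.
have [e|e] : kappa x = kappa z \/ kappa y = kappa w by lia.
  by left; apply: kappa_inj.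
by right; apply: kappa_inj.
Qed.

Lemma cycle_pent (x y z w u : G) :
  adj x y -> adj y z -> adj z w -> adj w u -> adj u x -> False.
Proof. by move=> /adjP h1 /adjP h2 /adjP h3 /adjP h4 /adjP h5; lia. Qed.

Lemma cycle_nbrs (j : G) : exists z1 z2 : G, [/\ adj j z1, adj j z2 &
  forall z, adj j z -> z = z1 \/ z = z2].
Proof.
have jn := kappa_lt j.
have [|z1 e1] := @kappa_surj (if (kappa j).+1 == n then 0 else (kappa j).+1).
  by case: eqP; lia.
have [|z2 e2] := @kappa_surj (if kappa j == 0 then n.-1 else (kappa j).-1).
  by case: eqP; lia.
exists z1, z2; split; [apply/adjP|apply/adjP|].
- by move: e1; case: eqP; lia.
- by move: e2; case: eqP; lia.
move=> z /adjP h; have zn := kappa_lt z;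
  have [e|e] : kappa z = kappa z1 \/ kappa z = kappa z2.
- by move: e1 e2; case: eqP; case: eqP; lia.
- by left; apply: kappa_inj.
- by right; apply: kappa_inj.
Qed.

(** When all letters lie over one generator, the element fixes a vertex and the length is 0. The
    data [z1], [z2], [h] are returned because the parity of [s] on even cycles is read off from
    them. *)
Lemma tau_cycle (R : realType) (x : ext_vertex G) g : exists s :
  nat, tau R x g = (s%:R / 2)%R /\
  exists (z1 z2 : G) h, [\/ s = 2 * vdist z1 z1 h, s = 2 * vdist z2 z2 h |
        s = vdist z1 z2 h + vdist z2 z1 h].
Proof.
have Gconn := cycle_connected.
have /card_gt0P[a _] := Gconn.1.
have tau0 : tau R x g = 0%R -> exists s : nat, tau R x g = (s%:R / 2)%R /\
  exists (z1 z2 : G) h, [\/ s = 2 * vdist z1 z1 h, s = 2 * vdist z2 z2 h |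
        s = vdist z1 z2 h + vdist z2 z1 h].
  move=> ->; exists 0; rewrite mul0r; split => //; exists a, a, 1%g.
  by apply: Or31; rewrite /vdist vtx1 ext_dist0.
have [/tau0 //|[L [l [L0 lL hmin e]]]] := tau_min_word R Gconn x g.
have [[p pp]|np] := pselect (exists p, adj (l p).1 (l p.+1).1).
  pose l' m := l (p + m).
  have lL' i : l' (L + i) = l' i by rewrite /l' addnCA lL.
  have hmin' : min_word l' L by apply: min_word_shift.
  have L1 : 1 < L.
    by case: (L) L0 lL => [|[|?]] // _ lL1; move: pp; rewrite -(lL1 p) add1n adj_irr.
  have e0 : l' L = l p by rewrite /l' addnC lL.
  have e1 : l' L.+1 = l p.+1 by rewrite /l' -addn1 addnCA lL addn1.
  have cut N k v c : schedule (N.+2 * L) l' k v c ->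
     exists2 z, z = (l p).1 \/ z = (l p.+1).1 & goes_through (N.+2 * L) l' k v z L.
    move=> S; have [||ht|ht] := cut_edge_sched Gconn S cycle_tri cycle_sq cycle_pent (p
      := L).
    - by rewrite !mulSn; lia.
    - by rewrite e0 e1.
    - by exists (l p).1; [left|rewrite -e0].
    - by exists (l p.+1).1; [right|rewrite -e1].
  have [s [es hs]] := tau_of_cut R Gconn x L0 lL' hmin' cut.
  exists s; rewrite e -es tau_shift //; split => //.
  by exists (l p).1, (l p.+1).1, (ev (mkseq l' L)).
have [[p pp]|np'] := pselect (exists p, (l p).1 != (l p.+1).1).
  pose l' m := l (p.+1 + m).
  have lL' i : l' (L + i) = l' i by rewrite /l' addnCA lL.
  have hmin' : min_word l' L by apply: min_word_shift.
  have e0 : l' L = l p.+1 by rewrite /l' addnC lL.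
  have e1 : l' L.-1 = l p by rewrite /l' addSnnS prednK // addnC lL.
  have [z1 [z2 [_ _ z12]]] := cycle_nbrs (l p.+1).1.
  have cut N k v c : schedule (N.+2 * L) l' k v c ->
     exists2 z, z = z1 \/ z = z2 & goes_through (N.+2 * L) l' k v z L.
    move=> S; have [|||z jz ht] := cut_chain_sched Gconn S (p := L).
    - by rewrite L0 !mulSn; lia.
    - move=> r _; apply/negP => h; apply: np; exists (p.+1 + r).
      by rewrite -addnS.
    - by rewrite e0 e1.
    - by exists z => //; apply: z12; rewrite -e0.
  have [s [es hs]] := tau_of_cut R Gconn x L0 lL' hmin' cut.
  exists s; rewrite e -es tau_shift //; split => //.
  by exists z1, z2, (ev (mkseq l' L)).
apply: tau0; rewrite e; apply: (@tau_star_word R G Gconn l L (l 0).1) => i _.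
rewrite /in_star; apply/orP; left; elim: i => // i /eqP <-.
by apply: contraT => ne; case: np'; exists i; rewrite eq_sym.
Qed.

(** For even [n] the parity of [kappa] is a proper 2-colouring: the edge between [n - 1] and [0]
    flips it as well. *)
Lemma vdist_parity (z w : G) h :
  ~~ odd n -> odd (vdist z w h) = odd (kappa z) (+) odd (kappa w).
Proof.
move=> en; have Gconn := cycle_connected.
have [vs [sz pt lst]] := ext_dist_walk Gconn z w 1%g h.
rewrite /vdist -vtx1 -sz -lst; elim: vs z pt {sz lst} => [|y vs IH] z /=;
  first by rewrite addbb.
case/andP=> /adjP zy /IH ->; have : odd (kappa y) = ~~ odd (kappa z) by lia.
by move=> ->; case: (odd (kappa z)); case: (odd _).
Qed.

(** * A non-integral translation length on odd cycles *)

Section OddExample.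
Variable m : nat.
Hypothesis nm : n = 2 * m + 1.
Variable K : nat.
Hypothesis mK : K + 3 = 2 * m.
Variable nu : nat -> G.
Hypothesis nuK : forall i, i < n -> kappa (nu i) = i.

Let Gconn := cycle_connected.

Lemma modn_eq_cases a b : a < 2 * n -> b < 2 * n -> a = b %[mod n] ->
  a = b \/ (a = b + n \/ b = a + n).
Proof.
have reduce c : c < 2 * n -> c %% n = (if c < n then c else c - n).
  move=> c2; case: ltnP => [/modn_small //|nc].
  by rewrite -{1}(subnK nc) modnDr modn_small //; lia.
move=> a2 b2; rewrite (reduce a a2) (reduce b b2); case: ltnP => h1;
  case: ltnP => h2 h3; lia.
Qed.

(** [i] counts the steps in the increasing direction; the congruence is end = start + i - (length -
    i), freed of subtraction. *)
Lemma walk_mod x vs : path adj x vs -> exists2 i, i <= size vs &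
  kappa (last x vs) + size vs = kappa x + 2 * i %[mod n].
Proof.
elim: vs x => [|y vs IH] x /=; first by exists 0; rewrite // muln0.
case/andP=> /adjP xy /IH[i ile e].
have [h|h] : kappa y + 1 = kappa x + 2 %[mod n] \/ kappa y + 1 = kappa x %[mod n].
- case: xy => [xy|[xy|[[x0 xy]|[x0 xy]]]].
  + by left; rewrite -xy; congr (_ %% _); lia.
  + by right; rewrite -xy addn1.
  + by right; rewrite x0 addn1 xy modnn mod0n.
  + left; rewrite x0 (_ : kappa x + 2 = 0 + 1 + n) ?modnDr //; lia.
- exists i.+1 => //; have -> : kappa x + 2 * i.+1 = (kappa x + 2) + 2 * i by lia.
  rewrite -[in RHS]modnDml -h modnDml -addn1 addnA -modnDml e modnDml.
  by congr (_ %% _); lia.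
- exists i; first exact: ltnW.
  rewrite -[in RHS]modnDml -h modnDml -addn1 addnA -modnDml e modnDml.
  by congr (_ %% _); lia.
Qed.

Lemma walk_forward x d : exists2 vs, path adj x vs &
  size vs = d /\ kappa (last x vs) = (kappa x + d) %% n.
Proof.
elim: d x => [|d IH] x; first by exists [::]; rewrite // addn0 modn_small.
have n0 : 0 < n by lia.
pose y := nu ((kappa x).+1 %% n).
have ky : kappa y = (kappa x).+1 %% n by rewrite nuK // ltn_pmod.
have xy : adj x y.
  apply/adjP; rewrite ky; have := kappa_lt x; rewrite leq_eqVlt => /orP[/eqP e|lt].
    by right; right; right; rewrite e modnn.
  by left; rewrite modn_small.
have [vs hp [sz e]] := IH y; exists (y :: vs); rewrite /= ?xy ?sz //.
by rewrite e ky modnDml addSnnS.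
Qed.

(* Consecutive letters of the word below are almost opposite on the cycle. Passing
   from one side of a letter to the opposite side of the next one costs [m - 2] or
   [m - 1] alternately, and staying on the same side costs [m]; as [n] is odd, the
   period [n] of the word exchanges the two sides. *)
Definition lab t := nu ((t * m) %% n).
Definition letter t : G * bool := (lab t, true).
(* [side t true] and [side t false] are the neighbours [lab t + 1] and [lab t - 1];
   modulo [n = 2 m + 1], [- 1] is [2 m]. *)
Definition shift (e : bool) := if e then 1 else 2 * m.
Definition side t e := nu ((t * m + shift e) %% n).
Definition pt t e := vtx (side t e) (ev (mkseq letter t)).

Lemma n_gt0 : 0 < n. Proof. by lia. Qed.

Lemma kappa_lab t : kappa (lab t) = (t * m) %% n.
Proof. by rewrite nuK // ltn_pmod // n_gt0. Qed.

Lemma kappa_side t e : kappa (side t e) = (t * m + shift e) %% n.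
Proof. by rewrite nuK // ltn_pmod // n_gt0. Qed.

Lemma side_adj t e : adj (lab t) (side t e).
Proof.
apply/adjP; rewrite kappa_lab kappa_side -modnDml.
have := ltn_pmod (t * m) n_gt0; move: (_ %% n) => r rn; rewrite /shift.
case: e.
  rewrite addn1; move: rn; rewrite leq_eqVlt => /orP[/eqP e|lt].
    by right; right; right; rewrite e modnn.
  by left; rewrite modn_small.
case: r rn => [|r] rn; first by right; right; left; rewrite add0n modn_small; lia.
have -> : r.+1 + 2 * m = r + n by lia.
by right; left; rewrite modnDr modn_small //; lia.
Qed.

Lemma adj_lab t z : adj (lab t) z -> exists e, z = side t e.
Proof.
have [z1 [z2 [_ _ h]]] := cycle_nbrs (lab t).
have ne : side t true <> side t false.
  move=> /(congr1 kappa); rewrite !kappa_side /shift => /eqP; rewrite eqn_modDl => /eqP.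
  by rewrite !modn_small; lia.
have h1 := h _ (side_adj t true); have h2 := h _ (side_adj t false).
move=> /h hz; suff [->|->] : z = side t true \/ z = side t false.
- by exists true.
- by exists false.
by case: hz h1 h2 => -> [e1|e1] [e2|e2]; rewrite ?e1 ?e2; auto; case: ne; rewrite e1 e2.
Qed.

(** With letter [t] absorbed, [pt t e] and [pt t.+1 e'] carry the same group element, so their
    distance is compared with walks in a single cycle. *)
Lemma pt_next t e : pt t e = vtx (side t e) (ev (mkseq letter t.+1)).
Proof.
rewrite /pt mkseqS -cats1 ev_cat vtx_star //=.
by rewrite /in_star /= adj_sym side_adj orbT.
Qed.

Lemma walk_next t e e' vs : path adj (side t e) vs -> last (side t e) vs = side t.+1 e' ->
  exists2 i, i <= size vs & m + shift e' + size vs = shift e + 2 * i %[mod n].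
Proof.
move=> /walk_mod[i ile h] hl; exists i => //; move: h; rewrite hl !kappa_side !modnDml.
rewrite mulSn (_ : m + t * m + shift e' + size vs = t * m + (m + shift e' + size vs));
  last by lia.
by rewrite -[_ + _ + 2 * i]addnA => /eqP; rewrite eqn_modDl => /eqP.
Qed.

(** A potential that levels the alternating costs: with it, [m - 2] from [true] to [false] and
    [m - 1] back both count as [K / 2], where [K = (m - 2) + (m - 1)]. *)
Definition phi (e : bool) := if e then 0 else 1.

Lemma step_lower t e e' : K + phi e <= 2 * ext_dist (pt t e) (pt t.+1 e') + phi e'.
Proof.
rewrite pt_next /pt.
have [vs [<- hp hl]] := ext_dist_walk Gconn (side t e) (side t.+1 e') (ev (mkseq letter
  t.+1)) (ev (mkseq letter t.+1)).
have [i ile h] := walk_next hp hl; rewrite leqNgt; apply/negP => lt.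
move: h; case: e lt {hp hl}; case: e'; rewrite /phi /shift => lt h.
- by have := modn_eq_cases _ _ h; lia.
- have {}h : m - 1 + size vs = 1 + 2 * i %[mod n].
    by rewrite -h -[LHS]modnDr; congr (_ %% _); lia.
  by have := modn_eq_cases _ _ h; lia.
- by have := modn_eq_cases _ _ h; lia.
- have {}h : m + size vs = 2 * i %[mod n].
    have := h; rewrite (_ : m + 2 * m + size vs = 2 * m + (m + size vs)); last by lia.
    by move/eqP; rewrite eqn_modDl => /eqP.
  by have := modn_eq_cases _ _ h; lia.
Qed.

Lemma step_forward t e e' d : t.+1 * m + shift e' = t * m + shift e + d %[mod n] ->
  ext_dist (pt t e) (pt t.+1 e') <= d.
Proof.
move=> h; rewrite pt_next /pt; have [vs hp [sz hl]] := walk_forward (side t e) d.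
have <- : last (side t e) vs = side t.+1 e'.
  by apply: kappa_inj; rewrite hl !kappa_side modnDml h.
by rewrite -sz; apply: walk_dist.
Qed.

Lemma step_backward t e e' d : t.+1 * m + shift e' + d = t * m + shift e %[mod n] ->
  ext_dist (pt t e) (pt t.+1 e') <= d.
Proof.
move=> h; rewrite ext_dist_sym // [pt t e]pt_next /pt;
  have [vs hp [sz hl]] := walk_forward (side t.+1 e') d.
have <- : last (side t.+1 e') vs = side t e.
  by apply: kappa_inj; rewrite hl !kappa_side modnDml h.
by rewrite -sz; apply: walk_dist.
Qed.

Lemma pt0 e : pt 0 e = ext_gen (side 0 e).
Proof. by rewrite /pt ev_nil vtx1. Qed.

(** Consecutive labels differ by [m], so they are distinct and not adjacent, and [cut_chain_sched]
    puts a side of each new letter on a geodesic. The step bounds then add up, with [phi]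
    telescoping. *)
Lemma pt_dist_ge t e e' :
  t.+1 * K + phi e <= 2 * ext_dist (pt 0 e) (pt t.+1 e') + phi e'.
Proof.
elim: t e' => [|t IH] e'; first by rewrite mul1n; apply: step_lower.
have rl : reduced (mkseq letter t.+2) by apply: red_mkseq => i j _ _ [].
have [v [c [S v0 vk]]] := geodesic_schedule Gconn (side 0 e) (side t.+2 e') rl.
have labne r : (lab r) != lab r.+1.
  apply/eqP => /(congr1 kappa); rewrite !kappa_lab mulSn -[in LHS](add0n (r * m)) => /eqP.
  by rewrite eqn_modDr mod0n modn_small; lia.
have nadj r : ~~ adj (lab r) (lab r.+1).
  apply/negP => h; have [|i ile] := @walk_mod (lab r) [:: lab r.+1];
    first by rewrite /= h.
  rewrite /= !kappa_lab !modnDml mulSn (_ : m + r * m + 1 = r * m + (m + 1)); last by lia.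
  move=> /eqP; rewrite eqn_modDl => /eqP e1; rewrite /= in ile.
  by have := modn_eq_cases _ _ e1; lia.
have [|||z /adj_lab[e'' ->]] := cut_chain_sched Gconn S (p := t.+1).
- by rewrite ltnSn.
- by move=> r _; apply: nadj.
- exact: labne.
rewrite /goes_through v0 vk -!/(pt _ _) -pt0.
have := IH e''; have := step_lower t.+1 e'' e'.
rewrite mulSn -/(pt t.+2 e'); lia.
Qed.

Lemma pt_dist_le t : 2 * ext_dist (pt 0 true) (pt t true) <= t * K + 3.
Proof.
have even s : ext_dist (pt 0 true) (pt (2 * s) true) <= s * K.
  elim: s => [|s IH]; first by rewrite muln0 ext_dist0.
  have -> : 2 * s.+1 = (2 * s).+2 by lia.
  have h1 : ext_dist (pt (2 * s) true) (pt (2 * s).+1 false) <= m - 2.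
    apply: step_forward; rewrite /shift mulSn -[RHS]modnDr.
    by congr (_ %% _); lia.
  have h2 : ext_dist (pt (2 * s).+1 false) (pt (2 * s).+2 true) <= m - 1.
    apply: step_backward; rewrite /shift mulSn.
    by congr (_ %% _); lia.
  have := ext_dist_triangle Gconn (pt (2 * s) true) (pt 0 true) (pt (2 * s).+2 true).
  have := ext_dist_triangle Gconn (pt (2 * s).+1 false) (pt (2 * s) true) (pt (2 *
    s).+2 true).
  by rewrite [s.+1 * K]mulSn; lia.
(* A last odd step stays on the same side at cost [m], and [2 * m = K + 3]. *)
rewrite -(odd_double_half t) -mul2n; have := even t./2; case: (odd t) => h.
  have h1 : ext_dist (pt (2 * t./2) true) (pt (2 * t./2).+1 true) <= m.
    by apply: step_forward; rewrite mulSn; congr (_ %% _); lia.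
  have := ext_dist_triangle Gconn (pt (2 * t./2) true) (pt 0 true) (pt (2 * t./2).+1
    true).
  by rewrite add1n [_.+1 * K]mulSn -mulnA; lia.
by rewrite add0n -mulnA; lia.
Qed.

Lemma tau_odd_example (R : realType) :
  tau R (ext_gen (side 0 true)) (ev (mkseq letter n))^-1%g = ((n * K)%:R / 2)%R.
Proof.
have per i : letter (n + i) = letter i.
  by rewrite /letter /lab mulnDl -modnDml modnMr add0n.
have sper N : side (N * n) true = side 0 true.
  by rewrite /side mul0n -modnDml mulnAC modnMl.
apply: (tau_eq Gconn (K := 3)) => N; rewrite ext_act_expV -(ev_period per).
rewrite -[in vtx _ _](sper N) -/(pt (N * n) true) -pt0.
have h1 : N * (n * K) <= 2 * ext_dist (pt 0 true) (pt (N * n) true).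
  rewrite mulnA; case e : (N * n) => [|t] //.
  by have := pt_dist_ge t true true; rewrite /phi; lia.
have h2 : 2 * ext_dist (pt 0 true) (pt (N * n) true) <= N * (n * K) + 3.
  by rewrite mulnA; apply: pt_dist_le.
have h1' : (N%:R * (n * K)%:R <= 2 * (ext_dist (pt 0 true) (pt (N * n) true))%:R :> R)%R.
  by rewrite -!natrM ler_nat.
have h2' : (2 * (ext_dist (pt 0 true) (pt (N * n) true))%:R <= N%:R * (n * K)%:R + 3 :>
  R)%R.
  by rewrite -!natrM -natrD ler_nat.
apply/andP; split; lra.
Qed.

End OddExample.

End Cycles.

Local Open Scope classical_set_scope.
Local Open Scope ring_scope.

Theorem theorem4 (R : realType) (G : sgraph) :
  (tree_graph G ->
     Spec R G `<=` [set t : R | exists k : int, t = (2 * k)%:~R]) /\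
  (forall n : nat, (5 < n)%N -> ~~ odd n -> cycle_graph n G ->
     Spec R G `<=` [set t : R | exists k : int, t = k%:~R]) /\
  (forall n : nat, (5 < n)%N -> odd n -> cycle_graph n G ->
     Spec R G `<=` [set t : R | exists k : int, t = k%:~R / 2] /\
     exists2 t, Spec R G t & ~ exists k : int, t = k%:~R).
Proof.
split=> [Gtree _ [x [g ->]]|].
  by have [k ->] := tau_tree Gtree R x g; exists k%:Z; rewrite -PoszM.
split=> n n5 par Gcyc; have [kappa [klt kinj ksurj kadj]] := cycle_coord Gcyc.
  move=> _ [x [g ->]]; have [s [-> [z1 [z2 [h hs]]]]] :=
    tau_cycle n5 klt kinj ksurj kadj R x g.
  have es : ~~ odd s.
    case: hs => ->; rewrite ?oddM // oddD !(vdist_parity n5 klt kinj ksurj kadj) //.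
    by rewrite [X in _ (+) X]addbC addbb.
  exists (s./2)%:Z; rewrite -[in LHS](even_halfK es) -muln2 natrM mulfK ?pnatr_eq0 //.
split=> [_ [x [g ->]]|].
  by have [s [-> _]] := tau_cycle n5 klt kinj ksurj kadj R x g; exists s%:Z.
have [x0 _] : exists x0 : G, kappa x0 = 0%N by apply: ksurj; lia.
(* From [n] on the condition is void, and [x0] merely witnesses it. *)
have ex i : exists y, (i < n)%N -> kappa y = i.
  by case: (ltnP i n) => [/ksurj[y <-]|_]; [exists y|exists x0].
have [nu nuP] := choice ex.
pose m := n./2; have nm : n = (2 * m + 1)%N by rewrite /m; lia.
pose K := (2 * m - 3)%N; have mK : (K + 3 = 2 * m)%N by rewrite /K; lia.
exists ((n * K)%:R / 2).
  by rewrite -(tau_odd_example n5 klt kinj ksurj kadj nm mK nuP R); do 2!eexists.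
(* An integer value would make [n * K] even, although both factors are odd. *)
move=> [k /(congr1 (fun y => y * 2))]; rewrite divfK ?pnatr_eq0 // => e.
have {}e : ((n * K)%:Z)%:~R = (k * 2)%:~R :> R by rewrite intrM.
have oK : odd K by lia.
have : odd (n * K) by rewrite oddM par.
by move/intr_inj: e; move: (n * K)%N => N; lia.
Qed.
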